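(* In any dimension $d$ the combinatorial type of a $d$-simplex, of a $d$-cube, and of a $d$-crosspolytope can be realized as a reflexive polytope. There is no three-dimensional reflexive polytope that is combinatorially isomorphic to a dodecahedron or an icosahedron. There is no four-dimensional reflexive polytope that is combinatorially isomorphic to the 120-cell or the 600-cell.
   Context: Let $M\cong\mathbb Z^d$ be a lattice with dual lattice $N$. A ($d$-dimensional) reflexive polytope is a $d$-dimensional lattice polytope $P\subseteq M_{\mathbb R}$ (vertices in $M$) with $0\in\mathrm{int}\,P$ whose dual $P^*=\{y\in N_{\mathbb R}:\langle x,y\rangle\ge -1\ \forall x\in P\}$ is a lattice polytope. Two polytopes are combinatorially isomorphic if their face lattices are isomorphic. *)

(* Defs.v *)
From HB Require Import structures.
From mathcomp Require Import all_boot all_order all_algebra all_fingroup.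
From mathcomp Require Import alt.
From mathcomp Require Import boolp classical_sets functions cardinality reals.
From mathcomp Require Import topology normedtype.

Set Implicit Arguments.
Unset Strict Implicit.
Unset Printing Implicit Defensive.

Import Order.TTheory GRing.Theory Num.Theory.
Import numFieldNormedType.Exports.

Local Open Scope classical_set_scope.
Local Open Scope ring_scope.

(* A basis of the lattice M is fixed, and its dual basis in N: M and N are both
   the integer vectors of 'rV[R]_d, and the pairing is the dot product. *)
Definition pairing (R : realType) (d : nat) (x y : 'rV[R]_d) : R :=
  \sum_(i < d) x 0 i * y 0 i.

Definition lattice_point (R : realType) (d : nat) (x : 'rV[R]_d) : Prop :=
  forall i : 'I_d, x 0 i \is a Num.int.

Definition convex_hull (R : realType) (d : nat) (A : set 'rV[R]_d) :
    set 'rV[R]_d :=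
  [set x | exists n : nat, exists p : 'I_n -> 'rV[R]_d, exists c : 'I_n -> R,
    [/\ forall i, A (p i), forall i, 0 <= c i, \sum_(i < n) c i = 1
      & x = \sum_(i < n) c i *: p i]].

Definition polytope (R : realType) (d : nat) (P : set 'rV[R]_d) : Prop :=
  exists2 A : set 'rV[R]_d, finite_set A & P = convex_hull A.

(* The intersections of P with the hyperplanes of its valid inequalities.
   The inequality 0 <= 0 gives P itself, and 0 <= 1 gives the empty face. *)
Definition face (R : realType) (d : nat) (P F : set 'rV[R]_d) : Prop :=
  exists u : 'rV[R]_d, exists b : R,
    (forall x, P x -> pairing u x <= b) /\
    F = [set x | P x /\ pairing u x = b].

Definition vertex (R : realType) (d : nat) (P : set 'rV[R]_d)
    (v : 'rV[R]_d) : Prop :=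
  face P [set v].

Definition lattice_polytope (R : realType) (d : nat) (P : set 'rV[R]_d) :
    Prop :=
  polytope P /\ forall v, vertex P v -> lattice_point v.

Definition dual (R : realType) (d : nat) (P : set 'rV[R]_d) : set 'rV[R]_d :=
  [set y | forall x, P x -> -1 <= pairing x y].

(* Such a P is d-dimensional because its interior in 'rV[R]_d is nonempty. *)
Definition reflexive_polytope (R : realType) (d : nat) (P : set 'rV[R]_d) :
    Prop :=
  [/\ lattice_polytope P, interior P 0 & lattice_polytope (dual P)].

(* Isomorphism of the face lattices, that is, of the sets of faces ordered by
   inclusion. *)
Definition combinatorially_isomorphic (R : realType) (m n : nat)
    (P : set 'rV[R]_m) (Q : set 'rV[R]_n) : Prop :=
  exists2 f : set 'rV[R]_m -> set 'rV[R]_n,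
    set_bij (face P) (face Q) f &
    forall F G, face P F -> face P G -> (F `<=` G <-> f F `<=` f G).

(* The d-simplex lies in the hyperplane \sum_i x_i = 1 of R^(d+1). *)
Definition simplex (R : realType) (d : nat) : set 'rV[R]_d.+1 :=
  convex_hull (range (fun i : 'I_d.+1 => delta_mx 0 i)).

(* The cube and the crosspolytope are the unit balls of the l^oo and l^1 norms.
   In dimension 0 both are a point, as is the simplex. *)
Definition cube (R : realType) (d : nat) : set 'rV[R]_d :=
  [set x | forall i, `|x 0 i| <= 1].

Definition crosspolytope (R : realType) (d : nat) : set 'rV[R]_d :=
  [set x | \sum_(i < d) `|x 0 i| <= 1].

Definition golden (R : realType) : R := (1 + Num.sqrt 5) / 2.

(* All vectors obtained from v, whose entries must be nonnegative, by permuting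
   the entries with an element of G and then changing signs arbitrarily. *)
Definition signed_perms (R : realType) (n : nat) (G : {set 'S_n})
    (v : n.-tuple R) : set 'rV[R]_n :=
  [set x | exists2 s : 'S_n, s \in G & forall j, `|x 0 j| = tnth v (s j)].

(* The standard coordinates of the regular polytopes, centred at the origin.
   The even permutations of three entries are the cyclic ones. The order of the
   entries of v matters for Alt; it is such that the icosahedron and the
   dodecahedron, and likewise the 600-cell and the 120-cell, are polar to each
   other up to scaling. *)
Definition icosahedron (R : realType) : set 'rV[R]_3 :=
  convex_hull (signed_perms (Alt 'I_3) [tuple 0; golden R; 1]).

Definition dodecahedron (R : realType) : set 'rV[R]_3 :=
  convex_hull
    (signed_perms (Sym 'I_3) [tuple 1; 1; 1] `|`
     signed_perms (Alt 'I_3) [tuple 0; (golden R)^-1; golden R]).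

(* 8 + 16 + 96 = 120 vertices, of norm 2. *)
Definition cell600 (R : realType) : set 'rV[R]_4 :=
  convex_hull
    (signed_perms (Sym 'I_4) [tuple 2; 0; 0; 0] `|`
     signed_perms (Sym 'I_4) [tuple 1; 1; 1; 1] `|`
     signed_perms (Alt 'I_4) [tuple 1; golden R; (golden R)^-1; 0]).

(* 24 + 64 + 64 + 64 + 96 + 96 + 192 = 600 vertices, of norm 2 * sqrt 2. *)
Definition cell120 (R : realType) : set 'rV[R]_4 :=
  let phi := golden R in
  convex_hull
    (signed_perms (Sym 'I_4) [tuple 0; 0; 2; 2] `|`
     signed_perms (Sym 'I_4) [tuple 1; 1; 1; Num.sqrt 5] `|`
     signed_perms (Sym 'I_4) [tuple phi ^- 2; phi; phi; phi] `|`
     signed_perms (Sym 'I_4) [tuple phi^-1; phi^-1; phi^-1; phi ^+ 2] `|`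
     signed_perms (Alt 'I_4) [tuple 0; phi ^- 2; 1; phi ^+ 2] `|`
     signed_perms (Alt 'I_4) [tuple 0; phi^-1; phi; Num.sqrt 5] `|`
     signed_perms (Alt 'I_4) [tuple phi^-1; 1; phi; 2]).

Arguments simplex R d : clear implicits.
Arguments cube R d : clear implicits.
Arguments crosspolytope R d : clear implicits.
Arguments golden R : clear implicits.
Arguments icosahedron R : clear implicits.
Arguments dodecahedron R : clear implicits.
Arguments cell600 R : clear implicits.
Arguments cell120 R : clear implicits.

(* Main.v *)
Require Import Defs.
From Stdlib Require Import ZArith.
From mathcomp Require Import all_boot all_order all_algebra all_fingroup alt.
From mathcomp Require Import boolp classical_sets functions cardinality reals.
From mathcomp Require Import topology normedtype.
From mathcomp Require Import zify ssrZ lra ring.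

(** Let [P] be a reflexive polytope of dimension [d].  A vertex [v] of [P] and a
    vertex [u] of [dual P] have an integral pairing, which is at least [-1], and
    is [-1] exactly if [v] lies on the facet [u] of [P].

    Suppose that [P] is simple, so that each vertex [v] lies on [d] facets.  The
    edges at [v] form, up to scaling, the dual basis of these [d] facet normals.
    At most [d] facets [u] have pairing [0] with [v]: as [u] is not zero, it
    decreases along some edge at [v], so its pairing with the other end [v'] of
    that edge is [-1], and [u] is the only facet at [v'] that is not at [v].  All
    remaining pairings with [v] are at least [1].  If there are [f] facets and
    [x] is the sum of their normals, then the pairing of [v] and [x] is at least
    [f - 3 * d].  On the other hand, let [v] be a vertex at which the pairing
    with [x] is minimal.  The coefficients of [x] in the basis of facet normals
    at [v] are nonnegative, because [x] does not decrease along the edges at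
    [v], and each basis vector has pairing [-1] with [v], so the pairing of [v]
    and [x] is at most [0].  Hence [f <= 3 * d] ([simple_incidence_bound]).
    This is a variant of an argument of Casagrande.  Exchanging vertices and
    facets, a simplicial reflexive polytope has at most [3 * d] vertices.

    The dodecahedron and the 120-cell are simple, with 12 > 9 and 120 > 12
    facets; the icosahedron and the 600-cell are simplicial, with as many
    vertices.  The argument only sees which vertices lie on which facets, and
    [reflexive_incidence] transports this information along an isomorphism of
    face lattices.  For the four polytopes it is found by computing with the
    coordinates, which lie in the ring generated by the golden ratio.

    For the positive half, the cube and the crosspolytope are reflexive and
    dual to each other, and so is, in any dimension, the simplex with vertices
    [e_1, ..., e_d, - (e_1 + ... + e_d)] ([reflexive_pair]). *)

Set Implicit Arguments.
Unset Strict Implicit.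
Unset Printing Implicit Defensive.

Import Order.TTheory GRing.Theory Num.Theory.
Import numFieldNormedType.Exports.

Local Open Scope classical_set_scope.
Local Open Scope ring_scope.

(** * The pairing *)

Section Pairing.
Variables (R : realType) (d : nat).
Implicit Types x y z : 'rV[R]_d.

Lemma pairingE x y : pairing x y = (x *m y^T) 0 0.
Proof. by rewrite mxE; apply: eq_bigr => i _; rewrite mxE. Qed.

Lemma pairingC x y : pairing x y = pairing y x.
Proof. by apply: eq_bigr => i _; rewrite mulrC. Qed.

Lemma pairingDl x y z : pairing (x + y) z = pairing x z + pairing y z.
Proof. by rewrite !pairingE mulmxDl mxE. Qed.

Lemma pairingZl k x z : pairing (k *: x) z = k * pairing x z.
Proof. by rewrite !pairingE -scalemxAl mxE. Qed.

Lemma pairingNl x z : pairing (- x) z = - pairing x z.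
Proof. by rewrite -scaleN1r pairingZl mulN1r. Qed.

Lemma pairing0l z : pairing 0 z = 0.
Proof. by rewrite -(scale0r 0) pairingZl mul0r. Qed.

Lemma pairingBl x y z : pairing (x - y) z = pairing x z - pairing y z.
Proof. by rewrite pairingDl pairingNl. Qed.

Lemma pairing_suml (I : finType) (P : pred I) (F : I -> 'rV[R]_d) z :
  pairing (\sum_(i | P i) F i) z = \sum_(i | P i) pairing (F i) z.
Proof.
exact: (big_morph (fun x => pairing x z) (fun x y => pairingDl x y z) (pairing0l z)).
Qed.

Lemma pairingDr x y z : pairing z (x + y) = pairing z x + pairing z y.
Proof. by rewrite pairingC pairingDl !(pairingC z). Qed.

Lemma pairingZr k x z : pairing z (k *: x) = k * pairing z x.
Proof. by rewrite pairingC pairingZl (pairingC z). Qed.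

Lemma pairingNr x z : pairing z (- x) = - pairing z x.
Proof. by rewrite pairingC pairingNl (pairingC z). Qed.

Lemma pairing0r z : pairing z 0 = 0.
Proof. by rewrite pairingC pairing0l. Qed.

Lemma pairingBr x y z : pairing z (x - y) = pairing z x - pairing z y.
Proof. by rewrite pairingDr pairingNr. Qed.

Lemma pairing_sumr (I : finType) (P : pred I) (F : I -> 'rV[R]_d) z :
  pairing z (\sum_(i | P i) F i) = \sum_(i | P i) pairing z (F i).
Proof. by rewrite pairingC pairing_suml; under eq_bigr do rewrite pairingC. Qed.

Lemma pairing_ge0 x : 0 <= pairing x x.
Proof. by apply: sumr_ge0 => i _; rewrite -expr2 sqr_ge0. Qed.

Lemma pairing_eq0 x : pairing x x = 0 -> x = 0.
Proof.
move/eqP; rewrite psumr_eq0 => [/allP x0|i _]; last by rewrite -expr2 sqr_ge0.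
apply/rowP => i; rewrite mxE; have := x0 i (mem_index_enum _).
by rewrite mulf_eq0 orbb => /eqP.
Qed.

Lemma pairing_gt0 x : x != 0 -> 0 < pairing x x.
Proof.
by move=> x0; rewrite lt_def pairing_ge0 andbT; apply: contraNneq x0 => /pairing_eq0->.
Qed.

End Pairing.

(** * Convex hulls and their faces *)

Section ConvexHull.
Variables (R : realType) (d : nat).
Implicit Types (x y w : 'rV[R]_d) (A P F : set 'rV[R]_d).

Lemma convex_hull_rangeP (I : finType) (a : I -> 'rV[R]_d) x :
  convex_hull (range a) x <->
  exists c : I -> R, [/\ forall i, 0 <= c i, \sum_i c i = 1 & x = \sum_i c i *: a i].
Proof.
split=> [[n [p [c [ap c_ge0 c1 ->]]]]|[c [c_ge0 c1 ->]]].
  have /choice[h hp] : forall k, exists i, a i = p k.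
    by move=> k; have [i _] := ap k; exists i.
  exists (fun i => \sum_(k | h k == i) c k); split=> [i||].
  - exact: sumr_ge0.
  - by rewrite -c1 (partition_big h xpredT).
  - rewrite (partition_big h xpredT) //=; apply: eq_bigr => i _.
    by rewrite scaler_suml; apply: eq_bigr => k /eqP <-; rewrite hp.
exists #|I|, (fun k => a (enum_val k)), (fun k => c (enum_val k)); split=> //.
- by rewrite -c1 [RHS](reindex (@enum_val I xpredT)) //; apply/onW_bij/enum_val_bij.
- by rewrite [LHS](reindex (@enum_val I xpredT)) //; apply/onW_bij/enum_val_bij.
Qed.

Lemma sub_convex_hull A : A `<=` convex_hull A.
Proof.
move=> x Ax; exists 1%N, (fun=> x), (fun=> 1).
by split=> //; rewrite big_ord1 ?scale1r.
Qed.

Lemma convex_hull_le A w b : (forall x, A x -> pairing w x <= b) ->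
  forall x, convex_hull A x -> pairing w x <= b.
Proof.
move=> Ab x [n [p [c [Ap c_ge0 c1 ->]]]]; rewrite pairing_sumr -[b]mul1r -c1 mulr_suml.
by apply: ler_sum => i _; rewrite pairingZr ler_wpM2l // Ab.
Qed.

(** The gaps [b - pairing w (p i)] are nonnegative and average to zero. *)
Lemma convex_comb_tight (I : finType) (p : I -> 'rV[R]_d) (c : I -> R) w b :
  (forall i, 0 <= c i) -> \sum_i c i = 1 -> (forall i, pairing w (p i) <= b) ->
  pairing w (\sum_i c i *: p i) = b -> forall i, c i != 0 -> pairing w (p i) = b.
Proof.
move=> c_ge0 c1 pb wb i ci0.
have gap_ge0 j : true -> 0 <= c j * (b - pairing w (p j)).
  by rewrite mulr_ge0 // subr_ge0.
have gap0 : \sum_j c j * (b - pairing w (p j)) = 0.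
  under eq_bigr do rewrite mulrBr.
  rewrite sumrB -mulr_suml c1 mul1r -{1}wb pairing_sumr.
  by apply/eqP; rewrite subr_eq0; apply/eqP/eq_bigr => j _; rewrite pairingZr.
have /eqP := psumr_eq0P gap_ge0 gap0 (erefl true : xpredT i).
by rewrite mulf_eq0 (negPf ci0) subr_eq0 => /eqP.
Qed.

Lemma convex_weight_neq0 (I : finType) (c : I -> R) :
  \sum_i c i = 1 -> exists i, c i != 0.
Proof.
move=> c1; apply: contrapT => c0; move/eqP: c1; rewrite big1 => [|i _].
  by rewrite eq_sym oner_eq0.
by apply/eqP; apply: contraT => ci0; case: c0; exists i.
Qed.

Lemma vertex_convex_hull A v : vertex (convex_hull A) v -> A v.
Proof.
move=> [w [b [wb vE]]].
have [hv wv] : convex_hull A v /\ pairing w v = b by have : [set v] v by []; rewrite vE.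
case: (hv) => n [p [c [Ap c_ge0 c1 vp]]].
have [i ci0] := convex_weight_neq0 c1.
suff -> : v = p i by [].
apply/esym.
have : [set x | convex_hull A x /\ pairing w x = b] (p i); last by rewrite -vE.
split; first exact/sub_convex_hull.
apply: (convex_comb_tight c_ge0 c1) ci0; last by rewrite -vp.
by move=> j; apply/wb/sub_convex_hull.
Qed.

Lemma exposed_vertex A v w b : A v -> pairing w v = b ->
  (forall x, A x -> x != v -> pairing w x < b) -> vertex (convex_hull A) v.
Proof.
move=> Av wv Alt.
have Ale x : A x -> pairing w x <= b.
  by move=> Ax; have [->|xv] := eqVneq x v; [rewrite wv|exact/ltW/Alt].
exists w, b; split=> [x|]; first exact: convex_hull_le.
apply/seteqP; split=> [x ->|x /=]; first by split=> //; exact: sub_convex_hull.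
move=> [[n [p [c [Ap c_ge0 c1 ->]]]] wx].
have pv i : c i != 0 -> p i = v.
  move=> ci0; have wpi := convex_comb_tight c_ge0 c1 (fun j => Ale _ (Ap j)) wx ci0.
  by apply/eqP; apply: contraT => /(Alt _ (Ap i)); rewrite wpi ltxx.
rewrite -[RHS]scale1r -c1 scaler_suml; apply: eq_bigr => i _.
by have [->|/pv->] := eqVneq (c i) 0; rewrite ?scale0r.
Qed.

Lemma polytopeP P : polytope P ->
  exists n, exists a : 'I_n -> 'rV[R]_d, P = convex_hull (range a).
Proof.
move=> [A /finite_seqP[s ->] ->]; exists (size s), (tnth (in_tuple s)).
congr convex_hull; apply/seteqP; split=> [x /= xs|x [i _ <-] /=]; last exact: mem_tnth.
have /tnthP[i ->] : x \in in_tuple s by [].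
by exists i.
Qed.

(** Let [v] be a generator of [P] on [F] that is farthest from the origin.  By
    the Cauchy-Schwarz inequality, [pairing v] is maximal on [F] at [v] only, so
    tilting the functional of [F] slightly towards [v] exposes [v] in [P]. *)
Lemma face_has_vertex P F : polytope P -> face P F -> F !=set0 ->
  exists2 v, vertex P v & F v.
Proof.
move=> /polytopeP[n [a PE]] [c [b [cb FE]]] [x0]; rewrite FE => -[Px0 cx0].
have Pa i : P (a i) by rewrite PE; apply: sub_convex_hull; exists i.
have [i0 ci0] : exists i, pairing c (a i) == b.
  move: Px0; rewrite PE => /convex_hull_rangeP[l [l_ge0 l1 x0E]].
  have [i li0] := convex_weight_neq0 l1; exists i; apply/eqP.
  by apply: (convex_comb_tight l_ge0 l1 _ _ li0) => [j|]; rewrite -?x0E//; exact: cb.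
have [k /eqP ck kmax] := @arg_maxP _ _ _ i0 (fun i => pairing c (a i) == b)
  (fun i => pairing (a i) (a i)) ci0.
set v := a k in ck.
(* Scaling the functional of F by N outweighs any gain in pairing v off F. *)
pose q i : R := `|(pairing v (a i) - pairing v v) / (b - pairing c (a i))|.
pose N := 1 + \sum_i q i.
have qN i : q i < N.
  rewrite /N (bigD1 i) //= addrCA ltrDl ltr_wpDr ?ltr01//.
  by apply: sumr_ge0 => j _; exact: normr_ge0.
exists v; last by split; [exact: Pa|].
rewrite PE.
apply: (@exposed_vertex _ v (N *: c + v) (N * b + pairing v v)) => [||x [i _ <-] iv].
- by exists k.
- by rewrite pairingDl pairingZl ck.
rewrite pairingDl pairingZl.
have := cb _ (Pa i); rewrite le_eqVlt => /predU1P[cab|cab].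
  rewrite cab ltrD2l.
  have := pairing_gt0 (_ : a i - v != 0); rewrite subr_eq0 => /(_ iv).
  rewrite pairingBl !pairingBr (pairingC (a i) v).
  have := kmax i; rewrite cab eqxx -/v => /(_ isT) /= le_norm gt0; lra.
have gap : 0 < b - pairing c (a i) by rewrite subr_gt0.
have : pairing v (a i) - pairing v v < N * (b - pairing c (a i)).
  by rewrite -ltr_pdivrMr//; apply: le_lt_trans (qN i); exact: ler_norm.
by rewrite mulrBr => Ngap; lra.
Qed.

End ConvexHull.

(** * Proper faces of a polytope around the origin *)

Section PolarFacets.
Variables (R : realType) (d : nat).
Implicit Types (x y w : 'rV[R]_d) (P F : set 'rV[R]_d).

Lemma interior0_scale P w : interior P 0 -> exists2 e : R, 0 < e & P (e *: w).
Proof.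
move=> /nbhs_ballP[e /= e0 eP].
have w1 : 0 < 1 + `|w| by rewrite ltr_pwDl.
exists (e / (1 + `|w|)); first by rewrite divr_gt0.
apply: eP; rewrite -ball_normE /= sub0r normrN normrZ gtr0_norm ?divr_gt0//.
by rewrite mulrAC ltr_pdivrMr// ltr_pM2l// ltrDr ltr01.
Qed.

Lemma interior0_functional P w : interior P 0 ->
  (forall x, P x -> pairing w x <= 0) -> w = 0.
Proof.
move=> P0 wP; have [e e0 Pew] := interior0_scale w P0.
apply/pairing_eq0/eqP; rewrite eq_le pairing_ge0 andbT.
by have := wP _ Pew; rewrite pairingZr pmulr_rle0.
Qed.

Definition polar_facet P y := [set x | P x /\ pairing x y = -1].

Lemma polar_facet_face P y : dual P y -> face P (polar_facet P y).
Proof.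
move=> Py; exists (- y), 1; split=> [x /Py xy|].
  by rewrite pairingNl pairingC; lra.
apply/seteqP; split=> x [Px xy]; split=> //.
  by move: xy; rewrite pairingNl pairingC; lra.
by move: xy; rewrite pairingNl pairingC; lra.
Qed.

(** Since [0] is interior to [P], the bound of an inequality that defines a
    proper face is positive and can be scaled to [1]. *)
Lemma proper_face_polar P F : interior P 0 -> face P F -> F <> P ->
  exists2 y, dual P y & F = polar_facet P y.
Proof.
move=> P0 [w [b [wb FE]]] FP.
have Pz : P 0 by exact: interior_subset.
have b0 : 0 < b.
  have b_ge0 : 0 <= b by rewrite -(pairing0r w); exact: wb.
  rewrite lt_def b_ge0 andbT; apply: contra_notN FP => /eqP b0.
  have w0 : w = 0 by apply: (interior0_functional P0); rewrite -b0.
  rewrite FE w0 b0; apply/seteqP; split=> [x []//|x Px]; split=> //.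
  by rewrite pairing0l.
exists (- (b^-1 *: w)) => [x /wb wx|].
  by rewrite pairingNr pairingZr lerN2 mulrC ler_pdivrMr// mul1r pairingC.
rewrite FE; apply/seteqP; split=> x [Px wx]; split=> //.
  by rewrite pairingNr pairingZr pairingC wx mulVf// gt_eqF.
move: wx; rewrite pairingNr pairingZr pairingC => /oppr_inj /(congr1 ( *%R b)).
by rewrite mulr1 mulrA divff ?mul1r// gt_eqF.
Qed.

(** The points of [dual P] whose pairing with all of [F] is [-1] form a nonempty
    face of [dual P], exposed by the barycentre of the generators of [P] on [F].
    Any vertex of that face can serve as [u]. *)
Lemma proper_face_sub_polar_facet P F : polytope P -> interior P 0 ->
  polytope (dual P) -> face P F -> F !=set0 -> F <> P ->
  exists2 u, vertex (dual P) u & F `<=` polar_facet P u.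
Proof.
move=> /polytopeP[n [a PE]] P0 Pdual faceF [x0 Fx0] FP.
have [y Py FE] := proper_face_polar P0 faceF FP.
have Pa i : P (a i) by rewrite PE; apply: sub_convex_hull; exists i.
have supp x (c : 'I_n -> R) : (forall i, 0 <= c i) -> \sum_i c i = 1 ->
    x = \sum_i c i *: a i -> F x -> forall i, c i != 0 -> F (a i).
  move=> c_ge0 c1 xE; rewrite FE => -[_ xy] i ci0; split; first exact: Pa.
  apply: oppr_inj; rewrite -pairingNr pairingC.
  apply: (convex_comb_tight c_ge0 c1 _ _ ci0) => [j|].
    by rewrite pairingNl pairingC lerN2; exact/Py/Pa.
  by rewrite -xE pairingNl pairingC xy.
have PF x : P x -> exists c : 'I_n -> R,
    [/\ forall i, 0 <= c i, \sum_i c i = 1 & x = \sum_i c i *: a i].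
  by rewrite {1}PE => /convex_hull_rangeP.
pose J := [pred i | `[< F (a i) >]].
have [i0 Ji0] : exists i, J i.
  have [c [c_ge0 c1 x0E]] : exists c : 'I_n -> R,
    [/\ forall i, 0 <= c i, \sum_i c i = 1 & x0 = \sum_i c i *: a i].
    by apply: PF; move: Fx0; rewrite FE => -[].
  have [i ci0] := convex_weight_neq0 c1.
  by exists i; apply/asboolP; exact: (supp x0 c c_ge0 c1 x0E Fx0 i ci0).
have J0 : 0 < #|J|%:R :> R by rewrite ltr0n; apply/card_gt0P; exists i0.
pose w := - \sum_(i | J i) a i.
have wle z : dual P z -> pairing w z <= #|J|%:R.
  move=> Pz; rewrite pairingNl pairing_suml lerNl -sumr_const -sumrN.
  by apply: ler_sum => i _; exact/Pz/Pa.
pose G := [set z | dual P z /\ pairing w z = #|J|%:R].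
have Gy : G y.
  split=> //; rewrite pairingNl pairing_suml (eq_bigr (fun=> -1)) => [|i /asboolP].
    by rewrite sumrN opprK sumr_const.
  by rewrite FE => -[].
have [u uvert [Pu wu]] : exists2 u, vertex (dual P) u & G u.
  apply: face_has_vertex => //; last by exists y.
  by exists w, #|J|%:R; split.
exists u => // x Fx.
have [Px _] : P x /\ pairing x y = -1 by move: Fx; rewrite FE.
split=> //.
have ua i : J i -> pairing (a i) u = -1.
  move=> Ji.
  have gap_ge0 j : J j -> 0 <= pairing (a j) u + 1.
    by move=> _; rewrite -lerBlDr sub0r; exact/Pu/Pa.
  have gap0 : \sum_(j | J j) (pairing (a j) u + 1) = 0.
    rewrite big_split /= sumr_const -wu pairingNl pairing_suml.
    by rewrite subrr.
  by have /eqP := psumr_eq0P gap_ge0 gap0 Ji; rewrite addr_eq0 => /eqP.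
have [c [c_ge0 c1 xE]] := PF x Px.
transitivity (- \sum_i c i); last by rewrite c1.
rewrite xE pairing_suml -sumrN; apply: eq_bigr => i _.
rewrite pairingZl; have [->|ci0] := eqVneq (c i) 0; first by rewrite mul0r oppr0.
by rewrite ua ?mulrN1//; apply/asboolP; exact: (supp x c c_ge0 c1 xE Fx i ci0).
Qed.

Lemma face_total P : face P P.
Proof.
exists 0, 0; split=> [x|]; first by rewrite pairing0l.
by apply/seteqP; split=> x; [split=> //; rewrite pairing0l|case].
Qed.

Lemma face_empty P : face P set0.
Proof.
exists 0, 1; split=> [x|]; first by rewrite pairing0l.
apply/seteqP; split=> // x [_]; rewrite pairing0l => /eqP.
by rewrite eq_sym oner_eq0.
Qed.
End PolarFacets.

(** * Incidences of vertices and facets, and isomorphisms of face lattices *)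

Section IncidenceTransfer.
Variables (R : realType) (d : nat) (S T : finType).
Variables (a : S -> 'rV[R]_d) (b : T -> 'rV[R]_d) (k : R).
Hypothesis k0 : k != 0.
Hypothesis abk : forall i j, pairing (a i) (b j) <= k.
Hypothesis b_span : forall i x,
  (forall j, pairing (a i) (b j) = k -> pairing x (b j) = 0) -> x = 0.
Hypothesis a_span : forall j y,
  (forall i, pairing (a i) (b j) = k -> pairing (a i) y = 0) -> y = 0.

Local Notation Q := (convex_hull (range a)).
Let G j := [set x | Q x /\ pairing (b j) x = k].

Let Qb j x : Q x -> pairing (b j) x <= k.
Proof. by apply: convex_hull_le => _ [i _ <-]; rewrite pairingC. Qed.

Let Qa i : Q (a i). Proof. by apply: sub_convex_hull; exists i. Qed.

(** The sum of the [b j] with [pairing (a i) (b j) = k] exposes [a i], because a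
    point on all the hyperplanes of these [b j] is [a i]. *)
Lemma generator_vertex i : face Q [set a i].
Proof.
pose J := [pred j | pairing (a i) (b j) == k].
exists (\sum_(j | J j) b j), (#|J|%:R * k); split=> [x Qx|].
  by rewrite pairing_suml mulr_natl -sumr_const; apply: ler_sum => j _; exact: Qb.
apply/seteqP; split=> [x ->|x [Qx xE]] /=.
  split; first exact: Qa.
  rewrite pairing_suml mulr_natl -sumr_const; apply: eq_bigr => j /eqP <-.
  by rewrite pairingC.
apply/eqP; rewrite -subr_eq0; apply/eqP/(b_span (i := i)) => j /eqP Jj.
have gap_ge0 l : J l -> 0 <= k - pairing (b l) x by rewrite subr_ge0 => _; exact: Qb.
have gap0 : \sum_(l | J l) (k - pairing (b l) x) = 0.
  by rewrite sumrB sumr_const -pairing_suml xE mulr_natl subrr.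
have /eqP := psumr_eq0P gap_ge0 gap0 Jj.
by rewrite pairingBl (eqP Jj) (pairingC x) subr_eq0 => /eqP <-; rewrite subrr.
Qed.

Lemma generator_facet j : face Q (G j).
Proof. by exists (b j), k; split=> // x; exact: Qb. Qed.

(** A functional that is constant on the generators of [G j] is a multiple of
    [b j], because these generators span. *)
Lemma generator_facet_maximal j F : face Q F -> G j `<=` F -> F = G j \/ F = Q.
Proof.
move=> [w [c [wc FE]]] GF.
have w_tight i : pairing (a i) (b j) = k -> pairing (a i) w = c.
  move=> abjk; have : F (a i) by apply: GF; split; [exact: Qa|rewrite pairingC].
  by rewrite FE => -[_]; rewrite pairingC.
have wE : w = (c / k) *: b j.
  apply/eqP; rewrite -subr_eq0; apply/eqP/(a_span (j := j)) => i abjk.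
  by rewrite pairingBr pairingZr abjk (w_tight i abjk) divfK// subrr.
have [c0|c0] := eqVneq c 0.
  right; rewrite FE wE c0 mul0r scale0r; apply/seteqP; split=> [x []//|x Qx].
  by split=> //; rewrite pairing0l.
left; rewrite FE wE; apply/seteqP; split=> x /=; rewrite pairingZl => -[Qx bx].
  split=> //; apply: (mulfI (_ : c / k != 0)); last by rewrite bx divfK.
  by rewrite mulf_neq0 ?invr_neq0.
by rewrite bx divfK.
Qed.

Hypothesis facet_nonempty : forall j, exists i, pairing (a i) (b j) = k.
Hypothesis facet_proper : forall j, exists i, pairing (a i) (b j) != k.

(** The face of [P] that corresponds to the vertex [a i] of the hull contains a
    vertex [v i] of [P], and is therefore equal to it.  Dually, the face of [P]
    that corresponds to the facet of [b j] lies on the facet of a vertex [u j]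
    of [dual P], and is equal to that facet since facets of the hull are maximal.
    Vertices of [P] and [dual P] are lattice points, and inclusions of faces are
    preserved. *)
Lemma reflexive_incidence (P : set 'rV[R]_d) : reflexive_polytope P ->
  combinatorially_isomorphic P Q ->
  exists v : S -> 'rV[R]_d, exists u : T -> 'rV[R]_d,
  [/\ forall i, lattice_point (v i), forall j, lattice_point (u j),
      forall i j, -1 <= pairing (v i) (u j) &
      forall i j, (pairing (v i) (u j) == -1) = (pairing (a i) (b j) == k)].
Proof.
move=> [[polyP latP] P0 [polyD latD]] [f [fsub finj fsurj] ford].
have Pz : P 0 by exact: interior_subset.
have fface F : face P F -> face Q (f F) by move=> PF; apply: fsub.
have f0 : f set0 = set0.
  have [F PF fF] := fsurj _ (face_empty Q).
  apply/seteqP; split=> //; rewrite -{2}fF; apply/(ford _ _ (face_empty P) PF).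
  exact: sub0set.
have fP : f P = Q.
  have [F PF fF] := fsurj _ (face_total Q).
  apply/seteqP; split=> [x|].
    by have [w [c [_ ->]]] := fface _ (face_total P); case.
  rewrite -{1}fF; apply/(ford _ _ PF (face_total P)).
  by case: PF => [w [c [_ ->]]] x [].
have /choice[v vP] : forall i, exists v, vertex P v /\ f [set v] = [set a i].
  move=> i; have [F PF fF] := fsurj _ (generator_vertex i).
  have [v vP Fv] : exists2 v, vertex P v & F v.
    apply: face_has_vertex => //; apply/set0P/eqP => F0.
    have : [set a i] (a i) by [].
    by rewrite -fF F0 f0.
  exists v; split=> //.
  have sub : f [set v] `<=` [set a i].
    by rewrite -fF; apply/(ford _ _ vP PF) => x ->.
  apply/seteqP; split=> // x ->.
  have /set0P[z fz] : f [set v] != set0.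
    apply/eqP => fv0; have v0 : [set v] = set0.
      by apply: finj; [exact: mem_set|exact/mem_set/face_empty|rewrite fv0 f0].
    by have : [set v] v by []; rewrite v0.
  by have <- := sub _ fz.
have /choice[u uP] : forall j, exists u, vertex (dual P) u /\ f (polar_facet P u) = G j.
  move=> j; have [F PF fF] := fsurj _ (generator_facet j).
  have F0 : F !=set0.
    apply/set0P/eqP => F0; have [i abk_i] := facet_nonempty j.
    have : G j (a i) by split; [exact: Qa|rewrite pairingC].
    by rewrite -fF F0 f0.
  have FP : F <> P.
    move=> FP; have [i /eqP[]] := facet_proper j.
    have : f F (a i) by rewrite FP fP; exact: Qa.
    by rewrite fF => -[_]; rewrite pairingC.
  have [u uvert Fu] := proper_face_sub_polar_facet polyP P0 polyD PF F0 FP.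
  have Du : dual P u by case: uvert => w [c [_ /seteqP[/(_ u erefl) []]]].
  have faceu := polar_facet_face Du.
  exists u; split=> //.
  have [||//|fuQ] := @generator_facet_maximal j (f (polar_facet P u)).
  - exact: fface.
  - by rewrite -fF; apply/(ford _ _ PF faceu).
  have : P `<=` polar_facet P u.
    by apply/(ford _ _ (face_total P) faceu); rewrite fuQ fP.
  by move=> /(_ 0 Pz)[_]; rewrite pairing0l => /eqP; rewrite eq_sym oppr_eq0 oner_eq0.
have Pv i : P (v i) by case: (vP i) => -[w [c [_ /seteqP[/(_ (v i) erefl) []]]]].
have Du j : dual P (u j) by case: (uP j) => -[w [c [_ /seteqP[/(_ (u j) erefl) []]]]].
exists v, u; split=> [i|j|i j|i j].
- by apply: latP; case: (vP i).
- by apply: latD; case: (uP j).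
- exact: Du.
have [vvert fv] := vP i; have [uvert fu] := uP j.
have := ford _ _ vvert (polar_facet_face (Du j)); rewrite fv fu => incl.
apply/eqP/eqP => [vu|ab].
  have /incl/(_ (a i) erefl)[_] : [set v i] `<=` polar_facet P (u j) by move=> x ->.
  by rewrite pairingC.
have /incl/(_ (v i) erefl)[] : [set a i] `<=` G j; last by [].
by move=> x ->; split; [exact: Qa|rewrite pairingC].
Qed.
End IncidenceTransfer.

(** * A bound on simple incidences *)

(** The incidence of the vertices [S] and the facets [T] of a simple polytope of
    dimension [d], or of the facets [S] and the vertices [T] of a simplicial one:
    for each facet [t] at a vertex [s], an edge joins [s] to a vertex [s'] along
    the other facets at [s]. *)
Definition simple_incidence (d : nat) (S T : finType) (I : S -> T -> bool) :=
  forall s, #|[set t | I s t]%SET| = d /\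
    forall t, I s t -> exists s',
      ~~ I s' t /\ forall t', I s t' -> t' != t -> I s' t'.

Section SimpleIncidence.
Variables (R : realType) (d : nat) (S T : finType) (I : S -> T -> bool).
Variables (v : S -> 'rV[R]_d) (u : T -> 'rV[R]_d).
Hypothesis simpleI : simple_incidence d I.

(** The differences [v (nb t) - v s] along the edges at [s] are, up to scaling,
    the dual basis of the vectors [u t] incident to [s]. *)
Lemma incident_frame (k : R) s : (forall s t, (pairing (v s) (u t) == k) = I s t) ->
  exists nb : T -> S,
  [/\ forall t, I s t -> ~~ I (nb t) t,
      forall t t', I s t -> I s t' -> t' != t -> I (nb t) t' &
      forall x, x = \sum_(t | I s t)
        (pairing (v (nb t) - v s) x / pairing (v (nb t) - v s) (u t)) *: u t].
Proof.
move=> vuI; have [card_d nbP] := simpleI s.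
have {nbP} /choice[nb nbP] : forall t, exists s', I s t ->
    ~~ I s' t /\ forall t', I s t' -> t' != t -> I s' t'.
  by move=> t; case: (boolP (I s t)) => [/nbP[s' ?]|_]; [exists s'|exists s].
have nbI t t' : I s t -> I s t' -> t' != t -> I (nb t) t'.
  by move=> /nbP[_ +] Ist' tt'; apply.
exists nb; split=> // [t /nbP[]//|x].
set D := [set t | I s t]%SET.
have DI t : (t \in D) = I s t by rewrite inE.
pose w t := v (nb t) - v s.
have vuK s' t : I s' t -> pairing (v s') (u t) = k by rewrite -vuI => /eqP.
have wu t t' : I s t -> I s t' -> t' != t -> pairing (w t) (u t') = 0.
  move=> It It' tt'; rewrite pairingBl.
  by rewrite (vuK s t' It') (vuK (nb t) t') ?subrr// nbI.
have wu0 t : I s t -> pairing (w t) (u t) != 0.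
  move=> It; rewrite pairingBl subr_eq0 (vuK s t It) vuI.
  by have [] := nbP t It.
pose e (i : 'I_d) : T := enum_val (cast_ord (esym card_d) i).
have eI i : I s (e i) by rewrite -DI enum_valP.
have e_inj : injective e by move=> i j /enum_val_inj /cast_ord_inj.
pose A := \matrix_(i < d) w (e i); pose B := \matrix_(i < d) u (e i).
have ABE : A *m B^T = diag_mx (\row_i pairing (w (e i)) (u (e i))).
  apply/matrixP => i j; rewrite !mxE.
  transitivity (pairing (w (e i)) (u (e j))).
    by apply: eq_bigr => l _; rewrite !mxE.
  have [->|ij] := eqVneq; first by rewrite mulr1n.
  by rewrite mulr0n wu // (inj_eq e_inj) eq_sym.
have Aunit : A \in unitmx.
  have : A *m B^T \in unitmx.
    rewrite ABE unitmxE det_diag unitfE; apply/prodf_neq0 => i _.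
    by rewrite mxE wu0.
  by rewrite unitmx_mul => /andP[].
set y := \sum_(t | _) _; apply/eqP; rewrite -subr_eq0; apply/eqP.
have Axy : A *m (x - y)^T = 0.
  apply/colP => i; rewrite !mxE.
  transitivity (pairing (w (e i)) (x - y)).
    by apply: eq_bigr => l _; rewrite !mxE.
  rewrite pairingBr pairing_sumr (bigD1 (e i)) //= big1 => [|t /andP[It ti]].
    by rewrite pairingZr -/(w _) divfK ?wu0// addr0 subrr.
  by rewrite pairingZr wu ?mulr0.
by rewrite -[_ - _]trmxK -(mulKmx Aunit (_^T)) Axy mulmx0 trmx0.
Qed.

Lemma incident_span (k : R) : (forall s t, (pairing (v s) (u t) == k) = I s t) ->
  forall s x, (forall t, I s t -> pairing x (u t) = 0) -> x = 0.
Proof.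
move=> vuI s x xu; apply: pairing_eq0.
have [nb [_ _ xE]] := incident_frame s vuI.
rewrite {2}(xE x) pairing_sumr big1 // => t /xu.
by rewrite pairingZr => ->; rewrite mulr0.
Qed.

(** Expand [x] in the basis [u t'] at some [s] on [t].  The neighbours of [s]
    across the facets other than [t] lie on [t], which makes the coefficients of
    the other basis vectors vanish; the coefficient of [u t] vanishes because
    [v s] is itself on [t]. *)
Lemma coincident_span (k : R) : k != 0 ->
  (forall s t, (pairing (v s) (u t) == k) = I s t) ->
  forall t, (exists s, I s t) ->
  forall x, (forall s, I s t -> pairing (v s) x = 0) -> x = 0.
Proof.
move=> k0 vuI t [s Ist] x vx.
have [nb [_ nbI /(_ x) xE]] := incident_frame s vuI.
have xut : x = (pairing (v (nb t) - v s) x / pairing (v (nb t) - v s) (u t)) *: u t.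
  rewrite {1}xE (bigD1 t) //= big1 ?addr0// => t' /andP[Ist' t't].
  rewrite (_ : pairing _ x = 0) ?mul0r ?scale0r//.
  by rewrite pairingBl !vx ?subrr// nbI// eq_sym.
have : pairing (v s) x = 0 by apply: vx.
rewrite xut pairingZr; have /eqP-> : pairing (v s) (u t) == k by rewrite vuI.
by move/eqP; rewrite mulf_eq0 (negPf k0) orbF => /eqP->; rewrite scale0r.
Qed.

Section Bound.
Hypothesis incT : forall t, exists s, I s t.
Hypothesis vu_int : forall s t, pairing (v s) (u t) \is a Num.int.
Hypothesis vu_ge : forall s t, -1 <= pairing (v s) (u t).
Hypothesis vuI : forall s t, (pairing (v s) (u t) == -1) = I s t.

Let vuN s t : I s t -> pairing (v s) (u t) = -1.
Proof. by rewrite -vuI => /eqP. Qed.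

(** As in the simplex method, a functional that does not decrease along any edge
    at [s] is a nonnegative combination of the [u t] at [s].  Each of these is
    [-1] at [v s], so the functional is zero or negative at [v s]. *)
Lemma incident_frame_descent s : exists nb : T -> S,
  [/\ forall t, I s t -> ~~ I (nb t) t,
      forall t t', I s t -> I s t' -> t' != t -> I (nb t) t' &
      forall x, x != 0 -> 0 <= pairing (v s) x ->
        exists2 t, I s t & pairing (v (nb t)) x < pairing (v s) x].
Proof.
have [nb [nbN nbI uE]] := incident_frame s vuI; exists nb; split=> // x x0 sx.
case: (boolP [exists t, I s t && (pairing (v (nb t)) x < pairing (v s) x)]).
  by case/existsP => t /andP[]; exists t.
move/existsPn => noless; case/eqP: x0.
have wu_gt0 t : I s t -> 0 < pairing (v (nb t) - v s) (u t).
  move=> Ist; rewrite pairingBl subr_gt0 (vuN Ist).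
  by rewrite lt_def vuI nbN//= vu_ge.
pose a t := pairing (v (nb t) - v s) x / pairing (v (nb t) - v s) (u t).
have a_ge0 t : I s t -> 0 <= a t.
  move=> Ist; have := noless t; rewrite Ist /= -leNgt => xle.
  by apply: divr_ge0; [rewrite pairingBl subr_ge0|exact/ltW/wu_gt0].
have sxE : pairing (v s) x = - \sum_(t | I s t) a t.
  rewrite {1}(uE x) pairing_sumr -sumrN; apply: eq_bigr => t Ist.
  by rewrite pairingZr (vuN Ist) mulrN1.
have a0 : \sum_(t | I s t) a t = 0.
  by apply/eqP; rewrite eq_le sumr_ge0// andbT -oppr_ge0 -sxE.
rewrite (uE x) big1 // => t Ist.
by rewrite -/(a t) (psumr_eq0P a_ge0 a0 Ist) scale0r.
Qed.

(** If [u t'] vanishes at [v s], then it is negative, hence [-1], at a neighbour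
    of [s].  Each neighbour has just one incident [t'] that is not incident to
    [s]. *)
Lemma card_pairing0 s : (#|[set t | pairing (v s) (u t) == 0%R]%SET| <= d)%N.
Proof.
have [nb [nbN nbI descent]] := incident_frame_descent s.
pose ext t := [set t' | I (nb t) t' && ~~ I s t']%SET.
have ext1 t : I s t -> (#|ext t| <= 1)%N.
  move=> Ist.
  have tD : t \in [set t' | I s t']%SET by rewrite inE.
  have <- : (#|[set t' | I (nb t) t']%SET| - #|[set t' | I s t']%SET :\ t|)%N = 1%N.
    by rewrite (simpleI (nb t)).1 -(simpleI s).1 (cardsD1 t) tD addnK.
  rewrite -cardsDS; last first.
    by apply/fintype.subsetP => t'; rewrite !inE => /andP[t't Ist']; exact: nbI.
  apply/subset_leq_card/fintype.subsetP => t'; rewrite !inE => /andP[-> Nt'].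
  by rewrite (negPf Nt') andbF.
have sub : [set t | pairing (v s) (u t) == 0]%SET
    \subset (\bigcup_(t | I s t) ext t)%SET.
  apply/fintype.subsetP => t'; rewrite inE => /eqP vu0.
  have NIst' : ~~ I s t' by rewrite -vuI vu0 eq_sym oppr_eq0 oner_eq0.
  have ut'0 : u t' != 0.
    apply/eqP => u0; have [s1] := incT t'.
    by rewrite -vuI u0 pairing0r eq_sym oppr_eq0 oner_eq0.
  have [|t Ist] := descent _ ut'0; first by rewrite vu0.
  rewrite vu0 => lt0; apply/finset.bigcupP; exists t => //; rewrite inE NIst' andbT.
  rewrite -vuI eq_le vu_ge andbT.
  have /intrP[z zE] := vu_int (nb t) t'.
  move: lt0; rewrite zE -[0]/(0%:~R) -[-1]/((-1)%:~R) ltr_int ler_int.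
  by move=> ?; lia.
apply: leq_trans (subset_leq_card sub) _.
rewrite -(simpleI s).1 -sum1dep_card.
apply: (big_ind2 (fun (A : {set T}) n => (#|A| <= n)%N)) => //; first by rewrite cards0.
move=> A m B n Am Bn; apply: leq_trans (leq_card_setU A B) _; exact: leq_add.
Qed.

(** At every [v s], [d] of the [u t] are [-1], at most [d] are [0] and the others
    are positive integers, so their sum [x] is at least [#|T| - 3 * d].  At the
    [v s] where [x] is minimal, it is at most [0]. *)
Lemma simple_incidence_bound (s0 : S) : (#|T| <= 3 * d)%N.
Proof.
pose x := \sum_t u t.
pose s := [arg min_(s < s0) pairing (v s) x]%O.
have smin s' : pairing (v s) x <= pairing (v s') x.
  by rewrite /s; case: arg_minP => // i _; apply.
have sx0 : pairing (v s) x <= 0.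
  have [nb [_ _ descent]] := incident_frame_descent s.
  rewrite leNgt; apply/negP => sx.
  have [||t _] := descent x; last by rewrite ltNge smin.
    by apply: contraTneq sx => ->; rewrite pairing0r ltxx.
  exact: ltW.
have card_sum (P : pred T) : \sum_t (P t)%:R = #|[set t | P t]%SET|%:R :> R.
  by rewrite -natr_sum -sum1dep_card [in RHS]big_mkcond; congr _%:R;
    apply: eq_bigr => t _; case: (P t).
(* An integer z >= -1 is at least 1 - 2 [z = -1] - [z = 0]. *)
have : \sum_t (1 - (I s t)%:R *+ 2 - (pairing (v s) (u t) == 0)%:R) <= 0 :> R.
  apply: le_trans sx0; rewrite pairing_sumr; apply: ler_sum => t _.
  rewrite -vuI; have := vu_ge s t; have /intrP[z ->] := vu_int s t.
  rewrite -[-1]/((-1)%:~R) -[0]/(0%:~R) ler_int !eqr_int => z_ge.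
  have [->|z1] := eqVneq z (-1); first by rewrite /=; lra.
  have [->|z0] := eqVneq z 0; first by rewrite /=; lra.
  by rewrite mul0rn !subr0 -[1]/(1%:~R) ler_int; lia.
rewrite !sumrB sumrMnl !card_sum (simpleI s).1 sumr_const.
have zd := card_pairing0 s.
rewrite !lerBlDr add0r -mulrnA -natrD ler_nat => Tle.
by apply: leq_trans Tle _; lia.
Qed.
End Bound.
End SimpleIncidence.

(** * Simple and simplicial polytopes with many facets or vertices *)

Lemma lattice_pairing_int (R : realType) d (x y : 'rV[R]_d) :
  lattice_point x -> lattice_point y -> pairing x y \is a Num.int.
Proof. by move=> xi yi; apply: rpred_sum => i _; exact: rpredM. Qed.

Section NoReflexive.
Variables (R : realType) (d : nat) (S T : finType) (I : S -> T -> bool).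
Variables (a : S -> 'rV[R]_d) (b : T -> 'rV[R]_d) (k : R).
Hypothesis simpleI : simple_incidence d I.
Hypothesis incT : forall t, exists s, I s t.
Hypothesis k0 : k != 0.
Hypothesis abk : forall s t, pairing (a s) (b t) <= k.
Hypothesis abI : forall s t, (pairing (a s) (b t) == k) = I s t.
Hypothesis T_large : (3 * d < #|T|)%N.

Let abN s t : I s t <-> pairing (a s) (b t) = k.
Proof. by rewrite -abI; split=> [/eqP|->]. Qed.

Let s_of_t : exists s : S, True.
Proof.
have /card_gt0P[t _] : (0 < #|T|)%N by apply: leq_ltn_trans T_large.
by have [s _] := incT t; exists s.
Qed.

Let nonincident_s t : exists s, pairing (a s) (b t) != k.
Proof.
have [s Ist] := incT t; have [_ /(_ t Ist)[s' [NI _]]] := simpleI s.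
by exists s'; rewrite abI.
Qed.

Lemma simple_hull_not_reflexive (P : set 'rV[R]_d) : reflexive_polytope P ->
  ~ combinatorially_isomorphic P (convex_hull (range a)).
Proof.
move=> reflP isoP; have [s0 _] := s_of_t.
have [v [u [vlat ulat vu_ge vu]]] : exists v : S -> 'rV[R]_d, exists u : T -> 'rV[R]_d,
  [/\ forall i, lattice_point (v i), forall j, lattice_point (u j),
      forall i j, -1 <= pairing (v i) (u j) &
      forall i j, (pairing (v i) (u j) == -1) = (pairing (a i) (b j) == k)].
  apply: (reflexive_incidence k0 abk _ _ _ nonincident_s reflP isoP).
  - by move=> s x sx; apply: (incident_span simpleI abI (s := s)) => t /abN/sx.
  - move=> t x tx; apply: (coincident_span simpleI k0 abI (incT t)) => s /abN.
    exact: tx.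
  - by move=> t; have [s /abN] := incT t; exists s.
have /negP[] : ~~ (#|T| <= 3 * d)%N by rewrite -ltnNge.
apply: (simple_incidence_bound simpleI incT _ vu_ge _ s0) => s t.
  exact: lattice_pairing_int.
by rewrite vu abI.
Qed.

(** The bound applies with the vertices of [P] in the role of [u] and those of
    [dual P] in the role of [v]. *)
Lemma simplicial_hull_not_reflexive (P : set 'rV[R]_d) : reflexive_polytope P ->
  ~ combinatorially_isomorphic P (convex_hull (range b)).
Proof.
move=> reflP isoP; have [s0 _] := s_of_t.
have [u [v [ulat vlat uv_ge uv]]] : exists u : T -> 'rV[R]_d, exists v : S -> 'rV[R]_d,
  [/\ forall j, lattice_point (u j), forall i, lattice_point (v i),
      forall j i, -1 <= pairing (u j) (v i) &
      forall j i, (pairing (u j) (v i) == -1) = (pairing (b j) (a i) == k)].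
  apply: (reflexive_incidence k0 _ _ _ _ _ reflP isoP).
  - by move=> t s; rewrite pairingC.
  - move=> t x tx; apply: (coincident_span simpleI k0 abI (incT t)) => s /abN.
    by rewrite pairingC => /tx; rewrite pairingC.
  - move=> s x sx; apply: (incident_span simpleI abI (s := s)) => t /abN.
    by rewrite pairingC => /sx; rewrite pairingC.
  - move=> s; have [t Ist] : exists t, I s t.
      have /card_gt0P[t0 _] : (0 < #|T|)%N by apply: leq_ltn_trans T_large.
      have [s1 Is1] := incT t0.
      have : (0 < #|[set t | I s t]%SET|)%N.
        rewrite (simpleI s).1 -(simpleI s1).1.
        by apply/card_gt0P; exists t0; rewrite inE.
      by case/card_gt0P => t; rewrite inE; exists t.
    by exists t; rewrite pairingC; exact/abN.
  - move=> s; apply: contrapT => allinc; move: T_large; rewrite -(simpleI s).1.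
    suff -> : #|[set t | I s t]%SET| = #|T| by lia.
    apply: eq_card => t; rewrite !inE -abI pairingC.
    by apply: contra_notT allinc => ?; exists t.
have /negP[] : ~~ (#|T| <= 3 * d)%N by rewrite -ltnNge.
apply: (simple_incidence_bound (v := v) (u := u) simpleI incT _ _ _ s0) => s t.
- exact: lattice_pairing_int.
- by rewrite pairingC.
- by rewrite pairingC uv pairingC abI.
Qed.
End NoReflexive.

(** * Golden integers *)

(** The pair [(a, b)] stands for [a + b * phi], where [phi ^ 2 = phi + 1]. *)
Definition goldint : choiceType := (Z * Z)%type.

Section GoldenIntegers.
Local Open Scope Z_scope.

Definition goldint_of_Z (n : Z) : goldint := (n, 0).
Definition gphi : goldint := (0, 1).
Definition gadd (x y : goldint) : goldint := (x.1 + y.1, x.2 + y.2).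
Definition gopp (x : goldint) : goldint := (- x.1, - x.2).
Definition gmul (x y : goldint) : goldint :=
  (x.1 * y.1 + x.2 * y.2, x.1 * y.2 + x.2 * y.1 + x.2 * y.2).
(** A sufficient test: [a + b * x] is affine in [x], and the golden ratio lies
    between 1.618 and 1.619. *)
Definition gpos (x : goldint) : bool :=
  Z.ltb 0 (1000 * x.1 + 1618 * x.2) && Z.ltb 0 (1000 * x.1 + 1619 * x.2).
Definition gdot (x y : seq goldint) : goldint :=
  foldr (fun p s => gadd (gmul p.1 p.2) s) (goldint_of_Z 0) (zip x y).

End GoldenIntegers.

Notation g0 := (goldint_of_Z Z0).

Section GoldenValue.
Variable R : realType.
Local Notation phi := (golden R).

Lemma golden_sqr : phi ^+ 2 = phi + 1.
Proof.
have s5 : Num.sqrt (5 : R) ^+ 2 = 5 by rewrite sqr_sqrtr.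
rewrite /golden; move: s5; set s := Num.sqrt _ => s5.
by rewrite expr_div_n sqrrD s5; field.
Qed.

(** The polynomial [x ^ 2 - x - 1] increases on [x >= 1 / 2] and changes sign
    between the two bounds. *)
Lemma golden_bounds : 1618 / 1000 < phi < 1619 / 1000.
Proof.
have phi1 : 1 / 2 <= phi by rewrite /golden ler_pM2r ?invr_gt0// lerDl sqrtr_ge0.
have := golden_sqr; move: phi phi1 => x x1 xx; apply/andP; split.
  rewrite ltNge; apply/negP => xle.
  have := mulr_ge0 (_ : 0 <= 1618 / 1000 - x) (_ : 0 <= x - 1 / 2).
  by rewrite !subr_ge0 => /(_ xle x1); move: xx; rewrite expr2 => xx; lra.
rewrite ltNge; apply/negP => xle.
have := mulr_ge0 (_ : 0 <= x - 1619 / 1000) (_ : 0 <= x - 1 / 2).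
by rewrite !subr_ge0 => /(_ xle x1); move: xx; rewrite expr2 => xx; lra.
Qed.

Lemma golden_neq0 : phi != 0.
Proof. by have /andP[? _] := golden_bounds; apply/lt0r_neq0; lra. Qed.

Lemma goldenV : phi^-1 = phi - 1.
Proof.
apply: (mulfI golden_neq0); rewrite divff ?golden_neq0//.
by rewrite mulrBr mulr1 -expr2 golden_sqr; ring.
Qed.

Definition Zval (z : Z) : R := (int_of_Z z)%:~R.
Definition gvalue (x : goldint) : R := Zval x.1 + Zval x.2 * phi.

Lemma ZvalD x y : Zval (Z.add x y) = Zval x + Zval y.
Proof. by rewrite /Zval -intrD; congr (_%:~R); lia. Qed.

Lemma ZvalM x y : Zval (Z.mul x y) = Zval x * Zval y.
Proof. by rewrite /Zval -intrM; congr (_%:~R); lia. Qed.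

Lemma ZvalN x : Zval (Z.opp x) = - Zval x.
Proof. by rewrite /Zval -mulrNz; congr (_%:~R); lia. Qed.

Lemma gvalueD x y : gvalue (gadd x y) = gvalue x + gvalue y.
Proof. by rewrite /gvalue /= !ZvalD; ring. Qed.

Lemma gvalueN x : gvalue (gopp x) = - gvalue x.
Proof. by rewrite /gvalue /= !ZvalN; ring. Qed.

Lemma gvalueM x y : gvalue (gmul x y) = gvalue x * gvalue y.
Proof.
rewrite /gvalue /= !(ZvalD, ZvalM).
have -> : forall p q r s : R, (p + q * phi) * (r + s * phi) =
   p * r + (p * s + q * r) * phi + q * s * phi ^+ 2 by move=> *; ring.
by rewrite golden_sqr; ring.
Qed.

Lemma gvalue0 : gvalue g0 = 0.
Proof. by rewrite /gvalue /Zval /= mul0r addr0. Qed.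

Lemma gpos_gt0 x : gpos x -> 0 < gvalue x.
Proof.
case/andP => /Z.ltb_lt lo /Z.ltb_lt hi; rewrite /gvalue.
have Zpos z : Z.lt Z0 z -> 0 < Zval z by move=> z0; rewrite /Zval ltr0z; lia.
have {lo}lo := Zpos _ lo; have {hi}hi := Zpos _ hi.
move: lo hi; rewrite !(ZvalD, ZvalM).
have -> : Zval 1000 = 1000 by [].
have -> : Zval 1618 = 1618 by [].
have -> : Zval 1619 = 1619 by [].
have /andP[] := golden_bounds; move: (Zval x.1) (Zval x.2) => p q; nra.
Qed.

Definition gvec (d : nat) (r : seq goldint) : 'rV[R]_d := \row_j gvalue (nth g0 r j).

Lemma pairing_gvec d r s : size r = d -> size s = d ->
  pairing (gvec d r) (gvec d s) = gvalue (gdot r s).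
Proof.
move=> rd sd; rewrite /pairing; under eq_bigr do rewrite !mxE.
elim: d r s rd sd => [|d IHd] [|x r] [|y s] //= => [_ _|[rd] [sd]].
  by rewrite big_ord0 gvalue0.
rewrite big_ord_recl /= gvalueD gvalueM; congr (_ + _).
exact: IHd.
Qed.

End GoldenValue.

(** * Orbits of signed permutations *)

Section Orbits.

(** The sequences [w \o s] for the permutations [s] of parity [b].  The first
    entry has some index [j] in [w]; what remains is an arrangement of the other
    entries, whose parity differs from [b] by that of [j]. *)
Fixpoint arrangements (T : Type) (x0 : T) (n : nat) (b : bool) (w : seq T) :
    seq (seq T) :=
  if n is n'.+1 then
    flatten [seq [seq nth x0 w j :: z | z <- arrangements x0 n' (odd j (+) b)
                                             (take j w ++ drop j.+1 w)] | j <- iota 0 n]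
  else if b then [::] else [:: [::]].

(** Every permutation is [lift_perm ord0 j] of a permutation of the remaining
    indices, and [odd_lift_perm] gives its parity. *)
Lemma arrangementsP (T : eqType) (x0 : T) n b (w : seq T) r : size w = n ->
  reflect (exists2 s : 'S_n, odd_perm s = b & r = [seq nth x0 w (s i) | i <- enum 'I_n])
    (r \in arrangements x0 n b w).
Proof.
elim: n b w r => [|n IHn] b w r wn.
  have enum0 : enum 'I_0 = [::] by apply: size0nil; rewrite size_enum_ord.
  rewrite enum0; case: b => /=; apply: (iffP idP) => //.
  - by move=> [s]; rewrite (_ : s = 1%g) ?odd_perm1//; apply/permP => -[].
  - by rewrite inE => /eqP->; exists 1%g; rewrite ?odd_perm1.
  - by move=> [s _ ->]; rewrite inE.
have delE j k : (j < n.+1)%N ->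
    nth x0 (take j w ++ drop j.+1 w) k = nth x0 w (bump j k).
  move=> jn; rewrite nth_cat size_take wn jn /bump; case: leqP => kj.
    by rewrite nth_drop; congr nth; lia.
  by rewrite nth_take.
have del_size j : (j < n.+1)%N -> size (take j w ++ drop j.+1 w) = n.
  by move=> jn; rewrite size_cat size_take size_drop wn jn; lia.
have -> : arrangements x0 n.+1 b w = flatten
    [seq [seq nth x0 w j :: z
         | z <- arrangements x0 n (odd j (+) b) (take j w ++ drop j.+1 w)]
    | j <- iota 0 n.+1] by [].
apply: (iffP flattenP).
  move=> [_ /mapP[j + ->] /mapP[z + ->]]; rewrite mem_iota add0n => /andP[_ jn].
  move=> /(IHn _ _ _ (del_size j jn))[s sb ->].
  exists (lift_perm ord0 (Ordinal jn) s); first by rewrite odd_lift_perm sb /= addKb.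
  rewrite enum_ordSl /= lift_perm_id /= -map_comp; congr (_ :: _).
  apply: eq_map => i /=.
  by rewrite lift_perm_lift delE.
move=> [s sb ->]; set j := s ord0.
have /fin_all_exists[h hE] : forall k, exists k', s (lift ord0 k) = lift j k'.
  move=> k; have [k' sk|sk] := unliftP j (s (lift ord0 k)); first by exists k'.
  by have /perm_inj/eqP := sk; rewrite eq_sym (negPf (neq_lift _ _)).
have h_inj : injective h.
  by move=> x y hxy; apply: (@lift_inj _ ord0); apply: (@perm_inj _ s); rewrite !hE hxy.
have sE : s = lift_perm ord0 j (perm h_inj).
  apply/permP => i; have [k ->|->] := unliftP ord0 i; last by rewrite lift_perm_id.
  by rewrite lift_perm_lift hE permE.
exists [seq nth x0 w j :: z
       | z <- arrangements x0 n (odd j (+) b) (take j w ++ drop j.+1 w)].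
  by apply/mapP; exists (val j) => //; rewrite mem_iota add0n ltn_ord.
apply/mapP; exists [seq nth x0 w (bump j (perm h_inj i)) | i <- enum 'I_n].
  apply/(IHn _ _ _ (del_size _ (ltn_ord j))); exists (perm h_inj).
    by rewrite -sb {1}sE odd_lift_perm /= addKb.
  by apply: eq_map => i; rewrite delE.
rewrite enum_ordSl /= -map_comp; congr (_ :: _); apply: eq_map => i /=.
by rewrite {1}sE lift_perm_lift.
Qed.

(** A zero entry has one sign only, so that no sequence occurs twice. *)
Fixpoint sign_choices (r : seq goldint) : seq (seq goldint) :=
  if r is x :: r' then
    let Z := sign_choices r' in
    [seq y :: z | y <- if x == g0 then [:: x] else [:: x; gopp x], z <- Z]
  else [:: [::]].

Lemma sign_choicesP r z : reflect
  (size z = size r /\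
   forall j, nth g0 z j = nth g0 r j \/ nth g0 z j = gopp (nth g0 r j))
  (z \in sign_choices r).
Proof.
elim: r z => [|x r IHr] z; first by
  apply: (iffP idP) => [|[/size0nil-> _]//]; rewrite inE => /eqP->; split=> // j; left.
apply: (iffP allpairsP) => [[[y s] /= [yx /IHr[sz sr] ->]]|[]].
  split; first by rewrite /= sz.
  case=> [|j] /=; last exact: sr.
  move: yx; case: ifP => _; rewrite !inE; first by move/eqP; left.
  by case/orP => /eqP; [left|right].
case: z => [//|y s] /= [sz] yr; exists (y, s); split=> //=; last first.
  by apply/IHr; split=> // j; have := yr j.+1.
have := yr 0%N => /=; case: eqVneq => [->|_]; rewrite !inE; last first.
  by case=> ->; rewrite eqxx ?orbT.
by case=> ->.
Qed.

(** The parities in [bs] are those of the permutations allowed. *)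
Definition signed_arrangements (bs : seq bool) (w : seq goldint) : seq (seq goldint) :=
  flatten [seq sign_choices r
          | r <- undup (flatten [seq arrangements g0 (size w) b w | b <- bs])].

Definition gvec_set (R : realType) d (L : seq (seq goldint)) : set 'rV[R]_d :=
  [set x | exists2 r, r \in L & x = gvec R d r].

#[global] Arguments gvec_set R d L : clear implicits.

Lemma signed_permsE (R : realType) n (G : {set 'S_n}) bs (w : seq goldint)
    (v : n.-tuple R) :
  (forall s, (s \in G) = (odd_perm s \in bs)) -> all (fun x => (x == g0) || gpos x) w ->
  tval v = map (gvalue R) w ->
  signed_perms G v = gvec_set R n (signed_arrangements bs w).
Proof.
move=> GE w_ge0 vw.
have wn : size w = n by rewrite -(size_map (gvalue R)) -vw size_tuple.
have gvalue_ge0 x : x \in w -> 0 <= gvalue R x.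
  by move=> /(allP w_ge0)/orP[/eqP->|/(gpos_gt0 R)/ltW//]; rewrite gvalue0.
have vE (s : 'S_n) j : tnth v (s j) = gvalue R (nth g0 w (s j)).
  by rewrite (tnth_nth 0) vw (nth_map g0) // wn.
have rowE (s : 'S_n) (j : 'I_n) :
    nth g0 [seq nth g0 w (s i) | i <- enum 'I_n] j = nth g0 w (s j).
  by rewrite (nth_map j) ?size_enum_ord// nth_ord_enum.
apply/seteqP; split=> x /=.
  move=> [s sG xs].
  pose y j := if 0 <= x 0 j then nth g0 w (s j) else gopp (nth g0 w (s j)).
  pose z := [seq y j | j <- enum 'I_n].
  have zE (j : 'I_n) : nth g0 z j = y j.
    by rewrite (nth_map j) ?size_enum_ord// nth_ord_enum.
  exists z.
    apply/flattenP; exists (sign_choices [seq nth g0 w (s i) | i <- enum 'I_n]).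
      apply: map_f; rewrite mem_undup; apply/flattenP.
      exists (arrangements g0 (size w) (odd_perm s) w).
        by apply: map_f; rewrite -GE.
      by rewrite {1}wn; apply/arrangementsP => //; exists s.
    apply/sign_choicesP; split; first by rewrite !size_map.
    move=> j; have [jn|jn] := ltnP j n; last first.
      by left; rewrite !nth_default// size_map size_enum_ord.
    rewrite (zE (Ordinal jn)) (rowE s (Ordinal jn)) /y.
    by case: ifP => _; [left|right].
  apply/rowP => j; rewrite mxE zE /y; have := xs j; rewrite vE.
  case: ifP => [x_ge0|/negbT]; first by rewrite ger0_norm.
  by rewrite -ltNge => x_lt0; rewrite ltr0_norm// gvalueN => <-; rewrite opprK.
move=> [z /flattenP[_ /mapP[r + ->]]].
rewrite mem_undup => /flattenP[_ /mapP[b bbs ->]].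
rewrite {1}wn => /(arrangementsP _ _ _ wn)[s sb ->] /sign_choicesP[_ zr] ->.
exists s; first by rewrite GE sb.
move=> j; rewrite mxE vE; have := zr j; rewrite rowE.
have v0 : 0 <= gvalue R (nth g0 w (s j)) by rewrite gvalue_ge0// mem_nth// wn.
by case=> ->; rewrite ?gvalueN ?normrN ger0_norm.
Qed.

End Orbits.

(** * Polar pairs with golden coordinates *)

(** Let the edge at the vertex [s] that leaves the facet [t] end at [s'].  In a
    regular polytope [s'] is a combination of [s] and [t] by symmetry.  For the
    dodecahedron and for the 120-cell, the only such combinations that have the
    norm of [s] and lie on the other facets at [s] are [s] and [phi * s - t]. *)
Definition golden_neighbour (s t : seq goldint) : seq goldint :=
  [seq gadd (gmul gphi p.1) (gopp p.2) | p <- zip s t].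

(** Here [S] consists of the vertices of a simple polytope, [T] of its facet
    normals, all scaled so that [c] is the value of [gdot] on incident pairs. *)
Definition golden_certificate (d : nat) (c : goldint) (S T : seq (seq goldint)) :
    bool :=
  let incident s := [seq t <- T | gdot s t == c] in
  [&& gpos c, uniq T, (3 * d < size T)%N, all (fun t => size t == d) T,
      all (fun t => has (fun s => gdot s t == c) S) T &
      all (fun s => let I := incident s in
        [&& size s == d, size I == d,
            all (fun t => (gdot s t == c) || gpos (gadd c (gopp (gdot s t)))) T &
            all (fun t => let s' := golden_neighbour s t in
              [&& s' \in S, gdot s' t != c &
                  all (fun t' => (t' == t) || (gdot s' t' == c)) I]) I]) S].

Section Certificate.
Variables (R : realType) (d : nat) (c : goldint) (S T : seq (seq goldint)).
Hypothesis cert : golden_certificate d c S T.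

Let a (s : seq_sub S) := gvec R d (val s).
Let b (t : seq_sub T) := gvec R d (val t).
Let I (s : seq_sub S) (t : seq_sub T) := gdot (val s) (val t) == c.

Let cert_at (s : seq_sub S) :
  [/\ size (val s) = d, size [seq t <- T | gdot (val s) t == c] = d,
      forall t, t \in T ->
        (gdot (val s) t == c) || gpos (gadd c (gopp (gdot (val s) t))) &
      forall t, t \in T -> gdot (val s) t == c ->
        [/\ golden_neighbour (val s) t \in S, gdot (golden_neighbour (val s) t) t != c &
        forall t', t' \in T -> gdot (val s) t' == c -> t' != t ->
          gdot (golden_neighbour (val s) t) t' == c]].
Proof.
case/and5P: cert => _ _ _ _ /andP[_ /allP/(_ _ (valP s))].
case/and4P => /eqP sd /eqP Id /allP val_ok /allP nb_ok; split=> // t tT st.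
have /nb_ok/and3P[? ? /allP nb] : t \in [seq t <- T | gdot (val s) t == c].
  by rewrite mem_filter st.
split=> // t' t'T st' t't; have := nb t'; rewrite mem_filter st' t'T (negPf t't).
exact.
Qed.

Let size_T (t : seq_sub T) : size (val t) = d.
Proof. by case/and5P: cert => _ _ _ /allP/(_ _ (valP t))/eqP. Qed.

Let ab s t : pairing (a s) (b t) = gvalue R (gdot (val s) (val t)).
Proof. by rewrite pairing_gvec ?size_T//; case: (cert_at s). Qed.

Let abk s t : pairing (a s) (b t) <= gvalue R c.
Proof.
rewrite ab; have [_ _ /(_ _ (valP t))/orP[/eqP->//|gap _]] := cert_at s.
by have := gpos_gt0 R gap; rewrite gvalueD gvalueN subr_gt0 => /ltW.
Qed.

Let abI s t : (pairing (a s) (b t) == gvalue R c) = I s t.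
Proof.
rewrite ab /I; have [_ _ /(_ _ (valP t))/orP[st|gap _]] := cert_at s.
  by rewrite st (eqP st) eqxx.
have := gpos_gt0 R gap; rewrite gvalueD gvalueN subr_gt0 => lt_c.
by rewrite lt_eqF//; apply/esym; apply: contraTF lt_c => /eqP->; rewrite ltxx.
Qed.

Let card_T : #|{: seq_sub T}| = size T.
Proof. by case/and5P: cert => _ uT _ _ _; rewrite card_seq_sub. Qed.

Let simpleI : simple_incidence d I.
Proof.
move=> s; have [_ Id _ nb] := cert_at s; split.
  rewrite -[RHS]Id cardE -(size_map val); apply/perm_size/uniq_perm.
  - by rewrite (map_inj_uniq val_inj) enum_uniq.
  - by case/and5P: cert => _ uT _ _ _; rewrite filter_uniq.
  move=> t; rewrite mem_filter; apply/mapP/andP => [[t' + ->]|[st tT]].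
    by rewrite mem_enum inE => ?; split=> //; exact: valP.
  by exists (SeqSub tT); rewrite // mem_enum inE.
move=> t st; have [nbS nt nbt] := nb _ (valP t) st.
exists (SeqSub nbS); split=> // t' st' t't.
by apply: nbt => //; exact: valP.
Qed.

Let incT t : exists s, I s t.
Proof.
case/and5P: cert => _ _ _ _ /andP[/allP/(_ _ (valP t))/hasP[s sS st] _].
by exists (SeqSub sS).
Qed.

Let T_large : (3 * d < #|{: seq_sub T}|)%N.
Proof. by rewrite card_T; case/and5P: cert. Qed.

Let c0 : gvalue R c != 0.
Proof. by case/and5P: cert => /(gpos_gt0 R)/lt0r_neq0. Qed.

Let range_seq_sub (L : seq (seq goldint)) :
  gvec_set R d L = range (fun r : seq_sub L => gvec R d (val r)).
Proof.
apply/seteqP; split=> [x [r rL ->]|x [r _ <-]]; first by exists (SeqSub rL).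
by exists (val r) => //; exact: valP.
Qed.

Lemma golden_certificate_simple (P : set 'rV[R]_d) : reflexive_polytope P ->
  ~ combinatorially_isomorphic P (convex_hull (gvec_set R d S)).
Proof.
rewrite range_seq_sub.
exact: (simple_hull_not_reflexive simpleI incT c0 abk abI T_large).
Qed.

Lemma golden_certificate_simplicial (P : set 'rV[R]_d) : reflexive_polytope P ->
  ~ combinatorially_isomorphic P (convex_hull (gvec_set R d T)).
Proof.
rewrite range_seq_sub.
exact: (simplicial_hull_not_reflexive simpleI incT c0 abk abI T_large).
Qed.
End Certificate.

Section Coordinates.
Local Open Scope Z_scope.
(** From [phi ^ 2 = phi + 1] follow [phi ^ -1 = phi - 1], [phi ^ -2 = 2 - phi] and
    [sqrt 5 = 2 * phi - 1]. *)
Definition gphiV : goldint := (-1, 1).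
Definition gphi2 : goldint := (1, 1).
Definition gphiV2 : goldint := (2, -1).
Definition gsqrt5 : goldint := (-1, 2).

Local Notation "# n" := (goldint_of_Z n) (at level 1).
Let even := [:: false].
Let any := [:: false; true].

Definition icosahedron_points := signed_arrangements even [:: #0; gphi; #1].
Definition dodecahedron_points :=
  signed_arrangements any [:: #1; #1; #1] ++
  signed_arrangements even [:: #0; gphiV; gphi].
Definition cell600_points :=
  signed_arrangements any [:: #2; #0; #0; #0] ++
  signed_arrangements any [:: #1; #1; #1; #1] ++
  signed_arrangements even [:: #1; gphi; gphiV; #0].
Definition cell120_points :=
  signed_arrangements any [:: #0; #0; #2; #2] ++
  signed_arrangements any [:: #1; #1; #1; gsqrt5] ++
  signed_arrangements any [:: gphiV2; gphi; gphi; gphi] ++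
  signed_arrangements any [:: gphiV; gphiV; gphiV; gphi2] ++
  signed_arrangements even [:: #0; gphiV2; #1; gphi2] ++
  signed_arrangements even [:: #0; gphiV; gphi; gsqrt5] ++
  signed_arrangements even [:: gphiV; #1; gphi; #2].

(** Incident pairs have pairing [phi ^ 2] here, and [2 * phi ^ 2] for the 120-cell
    and the 600-cell. *)
Lemma dodecahedron_certificate :
  golden_certificate 3 (1, 1) dodecahedron_points icosahedron_points.
Proof. by vm_compute. Qed.

Lemma cell120_certificate :
  golden_certificate 4 (2, 2) cell120_points cell600_points.
Proof. by vm_compute. Qed.
End Coordinates.

Section Identification.
Variable R : realType.
Local Notation phi := (golden R).

Lemma SymE n (s : 'S_n) : (s \in Sym 'I_n) = (odd_perm s \in [:: false; true]).
Proof. by rewrite inE; case: odd_perm. Qed.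

Lemma AltE n (s : 'S_n) : (s \in Alt 'I_n) = (odd_perm s \in [:: false]).
Proof. by rewrite Alt_even inE; case: odd_perm. Qed.

Lemma gvalue_consts :
  ((gvalue R (goldint_of_Z 1) = 1) * (gvalue R (goldint_of_Z 2) = 2) *
   (gvalue R gphi = phi) * (gvalue R gphiV = phi^-1) * (gvalue R gphi2 = phi ^+ 2) *
   (gvalue R gphiV2 = phi ^- 2) * (gvalue R gsqrt5 = Num.sqrt 5))%type.
Proof.
have V2 : phi ^- 2 = 2 - phi.
  by rewrite -exprVn goldenV sqrrB golden_sqr; ring.
have Z0E : Zval R Z0 = 0 by [].
have Z1E : Zval R (Zpos 1) = 1 by [].
have Z2E : Zval R (Zpos 2) = 2 by [].
have ZN1E : Zval R (Zneg 1) = - 1 by [].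
have s5E : Num.sqrt 5 = 2 * phi - 1 by rewrite /golden; field.
rewrite V2 goldenV golden_sqr s5E /gvalue /= ?Z0E ?Z1E ?Z2E ?ZN1E.
by do !split; ring.
Qed.

Lemma gvec_set_cat d (L M : seq (seq goldint)) A B :
  A = gvec_set R d L -> B = gvec_set R d M -> A `|` B = gvec_set R d (L ++ M).
Proof.
move=> -> ->; apply/seteqP; split=> x /=.
  by move=> [] [r rLM ->]; exists r; rewrite // mem_cat rLM ?orbT.
by move=> [r]; rewrite mem_cat => /orP[rL|rM] ->; [left|right]; exists r.
Qed.

Let consts := (gvalue_consts, gvalue0).

Lemma icosahedronE : icosahedron R = convex_hull (gvec_set R 3 icosahedron_points).
Proof.
congr convex_hull.
by apply: signed_permsE; [exact: AltE|by []|rewrite /= !consts].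
Qed.

Lemma dodecahedronE : dodecahedron R = convex_hull (gvec_set R 3 dodecahedron_points).
Proof.
congr convex_hull; apply: gvec_set_cat; apply: signed_permsE;
  by [exact: SymE|exact: AltE|rewrite /= ?consts].
Qed.

Lemma cell600E : cell600 R = convex_hull (gvec_set R 4 cell600_points).
Proof.
congr convex_hull; rewrite -!setUA; do 2?apply: gvec_set_cat; apply: signed_permsE;
  by [exact: SymE|exact: AltE|rewrite /= ?consts].
Qed.

Lemma cell120E : cell120 R = convex_hull (gvec_set R 4 cell120_points).
Proof.
congr convex_hull; rewrite -!setUA; do 6?apply: gvec_set_cat; apply: signed_permsE;
  by [exact: SymE|exact: AltE|rewrite /= ?consts].
Qed.
End Identification.

(** * Reflexive realizations *)

Section ReflexivePair.
Variables (R : realType) (d : nat).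

Definition polar_set (I : finType) (a : I -> 'rV[R]_d) : set 'rV[R]_d :=
  [set y | forall i, -1 <= pairing (a i) y].

Lemma dual_convex_hull (I : finType) (a : I -> 'rV[R]_d) :
  dual (convex_hull (range a)) = polar_set a.
Proof.
apply/seteqP; split=> y ay; first by move=> i; apply/ay/sub_convex_hull; exists i.
move=> x ax; rewrite -[pairing x y]opprK lerN2 pairingC -pairingNl.
apply: convex_hull_le ax => _ [i _ <-].
by rewrite pairingNl pairingC lerNl; exact: ay.
Qed.

(** The radius is the inverse of a number that exceeds the l^1 norms of all
    [a i]. *)
Lemma polar_set_interior (I : finType) (a : I -> 'rV[R]_d) : interior (polar_set a) 0.
Proof.
pose C : R := 1 + \sum_i \sum_j `|a i 0 j|.
have C0 : 0 < C.
  by rewrite ltr_pwDl// sumr_ge0// => i _; apply: sumr_ge0 => j _; exact: normr_ge0.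
apply/nbhs_ballP; exists C^-1 => /=; first by rewrite invr_gt0.
move=> y yC i.
rewrite lerNl; apply: le_trans (_ : C * C^-1 <= 1); last by rewrite divff// gt_eqF.
apply: le_trans (_ : (\sum_j `|a i 0 j|) * C^-1 <= _); last first.
  rewrite ler_pM2r ?invr_gt0// /C (bigD1 i)//= addrCA lerDl addr_ge0//.
  by apply: sumr_ge0 => l _; apply: sumr_ge0 => j _; exact: normr_ge0.
rewrite -sumrN mulr_suml; apply: ler_sum => j _.
apply: le_trans (ler_norm _) _; rewrite normrN normrM ler_wpM2l//.
by have := yC.2 0 j; rewrite -ball_normE /= mxE sub0r normrN => /ltW.
Qed.

(** Either polytope is the dual of the other, and vertices are generators. *)
Lemma reflexive_pair (I J : finType) (a : I -> 'rV[R]_d) (b : J -> 'rV[R]_d) :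
  (forall i, lattice_point (a i)) -> (forall j, lattice_point (b j)) ->
  convex_hull (range a) = polar_set b -> convex_hull (range b) = polar_set a ->
  reflexive_polytope (convex_hull (range a)).
Proof.
move=> alat blat ab ba.
have lat (K : finType) (c : K -> 'rV[R]_d) : (forall i, lattice_point (c i)) ->
    lattice_polytope (convex_hull (range c)).
  move=> clat; split; first by exists (range c) => //; exact/finite_image/finite_finset.
  by move=> _ /vertex_convex_hull[i _ <-].
split; first exact: lat.
  by rewrite ab; exact: polar_set_interior.
by rewrite dual_convex_hull -ba; exact: lat.
Qed.

Lemma combinatorially_isomorphic_refl (P : set 'rV[R]_d) :
  combinatorially_isomorphic P P.
Proof. by exists id => //; split=> // F; exists F. Qed.

End ReflexivePair.

Definition affine_functional_pullback (R : realType) (p q : nat)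
    (f : 'rV[R]_p -> 'rV[R]_q) :=
  forall w, exists w', exists c, forall x, pairing w (f x) = pairing w' x + c.

(** The inequality of [F] is pulled back along the inverse [h] of [g]. *)
Lemma image_face (R : realType) (m n : nat) (P : set 'rV[R]_m) (Q : set 'rV[R]_n) g h :
  (forall x, P x -> Q (g x)) -> (forall y, Q y -> P (h y)) ->
  (forall x, P x -> h (g x) = x) -> (forall y, Q y -> g (h y) = y) ->
  affine_functional_pullback h -> forall F, face P F -> face Q (g @` F).
Proof.
move=> gQ hP gK hK aff F [w [b [wb ->]]].
have [w' [c wE]] := aff w; exists w', (b - c); split=> [y Qy|].
  by rewrite lerBrDr -wE; exact/wb/hP.
apply/seteqP; split=> [_ [x [Px xb] <-]|y [Qy yb]].
  by split; [exact: gQ|rewrite -xb -{2}(gK x Px) wE addrK].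
by exists (h y); [split; [exact: hP|rewrite wE yb subrK]|exact: hK].
Qed.

Lemma affine_isomorphic (R : realType) (m n : nat) (P : set 'rV[R]_m)
    (Q : set 'rV[R]_n) g h :
  (forall x, P x -> Q (g x)) -> (forall y, Q y -> P (h y)) ->
  (forall x, P x -> h (g x) = x) -> (forall y, Q y -> g (h y) = y) ->
  affine_functional_pullback g -> affine_functional_pullback h ->
  combinatorially_isomorphic P Q.
Proof.
move=> gQ hP gK hK affg affh.
have face_sub p (A B : set 'rV[R]_p) : face A B -> B `<=` A.
  by move=> [w [b [_ ->]]] x [].
have imK (p q : nat) (A F : set 'rV[R]_p) (g' : _ -> 'rV[R]_q) h' :
    (forall x, A x -> h' (g' x) = x) -> face A F -> h' @` (g' @` F) = F.
  move=> K /face_sub FA; apply/seteqP; split=> [_ [_ [x Fx <-] <-]|x Fx].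
    by rewrite K//; exact: FA.
  by exists (g' x); [exists x|rewrite K//; exact: FA].
exists (image^~ g); first split.
- by move=> F; exact: (image_face gQ hP gK hK affh).
- by move=> F G /set_mem PF /set_mem PG /(congr1 (image^~ h)) /=; rewrite !(imK _ _ P).
- move=> G QG; exists (h @` G); first exact: (image_face hP gQ hK gK affg).
  by rewrite (imK _ _ Q).
move=> F G PF PG; split=> [FG|gFG]; first exact: image_subset.
by rewrite -(imK _ _ P F g h gK PF) -(imK _ _ P G g h gK PG); exact: image_subset.
Qed.

Section CubeCrosspolytope.
Variables (R : realType) (d : nat).

Definition sign_vector (e : {ffun 'I_d -> bool}) : 'rV[R]_d :=
  \row_i (if e i then 1 else -1).
(** The origin is added to keep the family nonempty in dimension 0. *)
Definition axis_vector (p : option ('I_d * bool)) : 'rV[R]_d :=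
  if p is Some (i, e) then (if e then 1 else -1) *: delta_mx 0 i else 0.

Lemma pairing_delta (x : 'rV[R]_d) i : pairing (delta_mx 0 i) x = x 0 i.
Proof.
rewrite /pairing (bigD1 i)//= big1 ?addr0 ?mxE ?eqxx ?mul1r// => j ji.
by rewrite mxE (negPf ji) andbF mul0r.
Qed.

Lemma lattice_sign_vector e : lattice_point (sign_vector e).
Proof. by move=> i; rewrite mxE; case: ifP => _; rewrite ?rpredN rpred1. Qed.

Lemma lattice_axis_vector p : lattice_point (axis_vector p).
Proof.
case: p => [[i e]|] j; rewrite !mxE ?rpred0//.
by apply: rpredM; [case: e; rewrite ?rpredN rpred1|exact: rpred_nat].
Qed.

Lemma axis_polar : polar_set axis_vector = cube R d.
Proof.
apply/seteqP; split=> x /= xP.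
  move=> i; have := xP (Some (i, true)); have := xP (Some (i, false)).
  by rewrite /= !pairingZl pairing_delta mul1r mulN1r lerN2 ler_norml => -> ->.
case=> [[i e]|]; last by rewrite pairing0l lerN10.
have := xP i; rewrite /= pairingZl pairing_delta ler_norml => /andP[lo hi].
by case: e; rewrite ?mul1r ?mulN1r ?lerN2.
Qed.

Lemma sign_polar : polar_set sign_vector = crosspolytope R d.
Proof.
apply/seteqP; split=> x /= xP.
  have := xP [ffun i => x 0 i < 0]; rewrite -lerN2 opprK; apply: le_trans.
  rewrite -sumrN; apply: ler_sum => i _; rewrite mxE ffunE.
  by case: ltP => x0; [rewrite mul1r ltr0_norm|rewrite mulN1r opprK ger0_norm].
move=> e; rewrite -lerN2 opprK; apply: le_trans xP.
rewrite -sumrN; apply: ler_sum => i _; rewrite mxE.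
apply: le_trans (ler_norm _) _; rewrite normrN normrM.
by case: ifP; rewrite ?normrN normr1 mul1r.
Qed.

(** A point [x] of the cube is the mean of a random sign vector with independent
    entries of means [x 0 i]. *)
Lemma sign_hull : convex_hull (range sign_vector) = cube R d.
Proof.
apply/seteqP; split=> x.
  rewrite -axis_polar => xP p; rewrite -[pairing _ _]opprK lerN2 -pairingNl.
  apply: convex_hull_le xP => _ [e _ <-].
  rewrite pairingNl lerNl.
  have : polar_set axis_vector (sign_vector e); last exact.
  by rewrite axis_polar => i; rewrite mxE; case: ifP; rewrite ?normrN normr1.
move=> xP; apply/convex_hull_rangeP.
pose wt i (e : bool) := (1 + (if e then 1 else -1) * x 0 i) / 2.
exists (fun e : {ffun 'I_d -> bool} => \prod_i wt i (e i)); split=> [e||].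
- apply: prodr_ge0 => i _; rewrite divr_ge0//.
  by have := xP i; rewrite ler_norml => /andP[? ?]; case: (e i); lra.
- rewrite -(bigA_distr_bigA wt) big1// => i _.
  by rewrite big_bool /wt /=; field.
apply/rowP => j; rewrite summxE.
pose F i e := wt i e * (if i == j then (if e then 1 else -1) else 1).
transitivity (\prod_i \sum_e F i e).
  have Fsum i : \sum_e F i e = if i == j then x 0 j else 1.
    by rewrite big_bool /F /wt /=; case: eqP => [->|_]; field.
  by rewrite (eq_bigr _ (fun i _ => Fsum i)) -big_mkcond big_pred1_eq.
rewrite bigA_distr_bigA; apply: eq_bigr => e _.
rewrite !mxE big_split /=; congr (_ * _).
by rewrite (bigD1 j)//= eqxx big1 ?mulr1// => i /negPf->.
Qed.

(** The origin takes the weight that the l^1 norm leaves. *)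
Lemma axis_hull : convex_hull (range axis_vector) = crosspolytope R d.
Proof.
apply/seteqP; split=> x.
  rewrite -sign_polar => xP e; rewrite -[pairing _ _]opprK lerN2 -pairingNl.
  apply: convex_hull_le xP => _ [p _ <-].
  rewrite pairingNl lerNl.
  have : polar_set axis_vector (sign_vector e).
    by rewrite axis_polar => i; rewrite mxE; case: ifP; rewrite ?normrN normr1.
  by rewrite pairingC; exact.
move=> xP; apply/convex_hull_rangeP.
exists (fun p => if p is Some (i, e) then (`|x 0 i| + (if e then 1 else -1) * x 0 i) / 2
                 else 1 - \sum_i `|x 0 i|).
have optE (V : nmodType) (F : option ('I_d * bool) -> V) :
    \sum_p F p = F None + \sum_i (F (Some (i, true)) + F (Some (i, false))).
  rewrite (bigD1 None)//=; congr (_ + _).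
  rewrite (reindex_omap Some id) => [|[]//] /=.
  transitivity (\sum_(p : 'I_d * bool) F (Some (p.1, p.2))).
    by apply: eq_big => [p|[i e] _]//; rewrite eqxx.
  rewrite -(pair_bigA _ (fun i e => F (Some (i, e)))) /=.
  by apply: eq_bigr => i _; rewrite big_bool.
split=> [[[i e]|]||].
- have := ler_norm (x 0 i); have := ler_norm (- x 0 i); rewrite normrN => ? ?.
  by apply: divr_ge0 => //; case: e; lra.
- by rewrite subr_ge0; exact: xP.
- rewrite optE -[RHS](subrK (\sum_i `|x 0 i|)); congr (_ + _).
  by apply: eq_bigr => i _; rewrite mul1r mulN1r; field.
rewrite optE /= scaler0 add0r [LHS]row_sum_delta; apply: eq_bigr => i _.
by rewrite !scalerA -scalerDl; congr (_ *: _); field.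
Qed.


Lemma cube_reflexive : reflexive_polytope (cube R d).
Proof.
rewrite -sign_hull; apply: (reflexive_pair (b := axis_vector)).
- exact: lattice_sign_vector.
- exact: lattice_axis_vector.
- by rewrite axis_polar sign_hull.
- by rewrite sign_polar axis_hull.
Qed.

Lemma crosspolytope_reflexive : reflexive_polytope (crosspolytope R d).
Proof.
rewrite -axis_hull; apply: (reflexive_pair (b := sign_vector)).
- exact: lattice_axis_vector.
- exact: lattice_sign_vector.
- by rewrite sign_polar axis_hull.
- by rewrite axis_polar sign_hull.
Qed.

End CubeCrosspolytope.

Section Simplex.
Variables (R : realType) (d : nat).

Definition simplex_vertex (p : option 'I_d) : 'rV[R]_d :=
  if p is Some i then delta_mx 0 i else const_mx (-1).
Definition dual_simplex_vertex (p : option 'I_d) : 'rV[R]_d :=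
  const_mx (-1) + (if p is Some i then d.+1%:R *: delta_mx 0 i else 0).

Lemma pairing_const (c : R) (x : 'rV[R]_d) : pairing (const_mx c) x = c * \sum_i x 0 i.
Proof. by rewrite mulr_sumr; apply: eq_bigr => i _; rewrite mxE. Qed.

Let big_option (V : nmodType) (F : option 'I_d -> V) :
  \sum_p F p = F None + \sum_i F (Some i).
Proof.
rewrite (bigD1 None)//=; congr (_ + _).
rewrite (reindex_omap Some id) => [|[]//] /=.
by apply: eq_bigl => i; rewrite eqxx.
Qed.

Lemma pairing_dual_simplex_vertex p x : pairing (dual_simplex_vertex p) x =
  - \sum_i x 0 i + (if p is Some i then d.+1%:R * x 0 i else 0).
Proof.
rewrite /dual_simplex_vertex pairingDl pairing_const mulN1r; congr (_ + _).
by case: p => [i|]; rewrite ?pairing0l// pairingZl pairing_delta.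
Qed.

Let d1_neq0 : d.+1%:R != 0 :> R. Proof. by rewrite pnatr_eq0. Qed.
Let d1_gt0 : 0 < d.+1%:R :> R. Proof. by rewrite ltr0n. Qed.

(** The barycentric coordinate of [simplex_vertex None]; the one of
    [simplex_vertex (Some i)] is [x 0 i + weight x]. *)
Let weight (x : 'rV[R]_d) : R := (1 - \sum_i x 0 i) / d.+1%:R.

Let weightK x : d.+1%:R * weight x = 1 - \sum_i x 0 i.
Proof. by rewrite mulrC divfK. Qed.

Lemma lattice_simplex_vertex p : lattice_point (simplex_vertex p).
Proof. by case: p => [i|] j; rewrite mxE; [exact: rpred_nat|rewrite rpredN rpred1]. Qed.

Lemma lattice_dual_simplex_vertex p : lattice_point (dual_simplex_vertex p).
Proof.
move=> j; rewrite !mxE rpredD ?rpredN ?rpred1//.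
by case: p => [i|]; rewrite !mxE ?rpred0// rpredM ?rpred_nat.
Qed.

Lemma simplex_pairing_ge p q : -1 <= pairing (dual_simplex_vertex p) (simplex_vertex q).
Proof.
rewrite pairing_dual_simplex_vertex; case: q => [j|] /=.
  have -> : \sum_i (delta_mx 0 j : 'rV[R]_d) 0 i = 1.
    by rewrite -[LHS]mul1r -pairing_const pairingC pairing_delta mxE.
  by case: p => [i|]; rewrite ?addr0// mxE lerDl mulr_ge0// ler0n.
under eq_bigr do rewrite mxE; rewrite sumr_const card_ord mulNrn opprK.
case: p => [i|]; rewrite ?addr0; last by apply: le_trans (ler0n _ _); rewrite lerN10.
by rewrite mxE mulrN1 -natr1; lra.
Qed.

Lemma simplex_hull : convex_hull (range simplex_vertex) = polar_set dual_simplex_vertex.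
Proof.
apply/seteqP; split=> x.
  move=> xP p; rewrite -[pairing _ _]opprK lerN2 -pairingNl.
  apply: convex_hull_le xP => _ [q _ <-].
  by rewrite pairingNl lerNl simplex_pairing_ge.
move=> xP; apply/convex_hull_rangeP.
have w0 : 0 <= weight x.
  rewrite divr_ge0// subr_ge0 -lerN2.
  by have := xP None; rewrite pairing_dual_simplex_vertex addr0.
exists (fun p => if p is Some i then x 0 i + weight x else weight x); split=> [[i|]||].
- have := xP (Some i); rewrite pairing_dual_simplex_vertex => xi.
  by rewrite -(pmulr_rge0 _ d1_gt0) mulrDr weightK; lra.
- exact: w0.
- rewrite big_option big_split /= sumr_const card_ord addrCA -mulrS -mulr_natl weightK.
  by rewrite addrC subrK.
rewrite big_option /=; apply/rowP => i; rewrite mxE summxE !mxE mulrN1.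
rewrite (bigD1 i)//= big1 => [|j ji]; rewrite !mxE eqxx ?eqxx /=.
  by rewrite mulr1 addr0 addrC addrK.
by rewrite eq_sym (negPf ji) mulr0.
Qed.

Lemma dual_simplex_hull :
  convex_hull (range dual_simplex_vertex) = polar_set simplex_vertex.
Proof.
apply/seteqP; split=> y.
  move=> yP q; rewrite -[pairing _ _]opprK lerN2 -pairingNl.
  apply: convex_hull_le yP => _ [p _ <-].
  by rewrite pairingNl lerNl pairingC simplex_pairing_ge.
move=> yP; apply/convex_hull_rangeP.
pose c p := if p is Some i then (y 0 i + 1) / d.+1%:R else weight y.
have c1 : \sum_p c p = 1.
  apply: (mulfI d1_neq0); rewrite big_option mulrDr weightK -mulr_suml mulrCA divff//.
  by rewrite !mulr1 big_split /= sumr_const card_ord -natr1; ring.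
exists c; split=> // [[i|]|].
- rewrite divr_ge0 ?ler0n// -lerBlDr sub0r.
  by have := yP (Some i); rewrite /= pairing_delta.
- rewrite divr_ge0 ?ler0n// subr_ge0 -lerN2.
  by have := yP None; rewrite /= pairing_const mulN1r.
under eq_bigr do rewrite scalerDr.
rewrite big_split -scaler_suml c1 scale1r big_option scaler0 add0r /=.
under eq_bigr do rewrite scalerA divfK//.
rewrite [LHS](_ : y = const_mx (-1) + (y + const_mx 1)); last first.
  by apply/rowP => i; rewrite !mxE; ring.
by congr (_ + _); rewrite [LHS]row_sum_delta; apply: eq_bigr => i _; rewrite !mxE.
Qed.

Lemma simplex_reflexive : reflexive_polytope (convex_hull (range simplex_vertex)).
Proof.
apply: (reflexive_pair (b := dual_simplex_vertex)).
- exact: lattice_simplex_vertex.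
- exact: lattice_dual_simplex_vertex.
- exact: simplex_hull.
- exact: dual_simplex_hull.
Qed.

Lemma standard_simplexP (y : 'rV[R]_d.+1) :
  simplex R d y <-> (forall k, 0 <= y 0 k) /\ \sum_k y 0 k = 1.
Proof.
have sum_deltaE (c : 'I_d.+1 -> R) : \sum_k c k *: delta_mx 0 k = \row_k c k.
  by rewrite [RHS]row_sum_delta; apply: eq_bigr => k _; rewrite mxE.
split=> [/convex_hull_rangeP[c [c_ge0 c1 ->]]|[y_ge0 y1]].
  by rewrite sum_deltaE; split=> [k|]; [rewrite mxE|under eq_bigr do rewrite mxE].
apply/convex_hull_rangeP; exists (y 0); split=> //.
by rewrite sum_deltaE; apply/rowP => k; rewrite mxE.
Qed.

Let to_standard (x : 'rV[R]_d) : 'rV[R]_d.+1 :=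
  \row_k (if unlift ord0 k is Some i then x 0 i + weight x else weight x).
Let of_standard (y : 'rV[R]_d.+1) : 'rV[R]_d :=
  \row_i (y 0 (lift ord0 i) - y 0 ord0).

Let sum_of_standard (y : 'rV[R]_d.+1) : \sum_k y 0 k = 1 ->
  \sum_i of_standard y 0 i = 1 - d.+1%:R * y 0 ord0.
Proof.
rewrite big_ord_recl => y1; under eq_bigr do rewrite mxE.
rewrite sumrB sumr_const card_ord -(mulr_natl (y _ _)) -natr1.
by rewrite -[X in _ = X - _]y1; ring.
Qed.

(** Barycentric coordinates identify the two simplices. *)
Lemma simplex_isomorphic :
  combinatorially_isomorphic (convex_hull (range simplex_vertex)) (simplex R d).
Proof.
rewrite simplex_hull.
have to0 (x : 'rV[R]_d) : to_standard x 0 ord0 = weight x by rewrite mxE unlift_none.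
have toS (x : 'rV[R]_d) i : to_standard x 0 (lift ord0 i) = x 0 i + weight x.
  by rewrite mxE liftK.
have weight_of (y : 'rV[R]_d.+1) :
    \sum_k y 0 k = 1 -> weight (of_standard y) = y 0 ord0.
  move=> y1; apply: (mulfI d1_neq0); rewrite weightK sum_of_standard//; ring.
apply: (@affine_isomorphic _ _ _ _ _ to_standard of_standard).
- move=> x xP; apply/standard_simplexP; split=> [k|].
    have [i ->|->] := unliftP ord0 k;
      rewrite ?toS ?to0 -(pmulr_rge0 _ d1_gt0) ?mulrDr weightK.
      by have := xP (Some i); rewrite pairing_dual_simplex_vertex; lra.
    by have := xP None; rewrite pairing_dual_simplex_vertex; lra.
  rewrite big_ord_recl to0 (eq_bigr _ (fun i _ => toS x i)) big_split /=.
  rewrite sumr_const card_ord addrCA -mulrS -mulr_natl weightK; ring.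
- move=> y /standard_simplexP[y_ge0 y1] p.
  rewrite pairing_dual_simplex_vertex sum_of_standard//.
  have y0 : 0 <= d.+1%:R * y 0 ord0 by rewrite mulr_ge0 ?ler0n.
  case: p => [i|]; last by lra.
  have yi : 0 <= d.+1%:R * y 0 (lift ord0 i) by rewrite mulr_ge0 ?ler0n.
  by rewrite mxE mulrBr; lra.
- by move=> x _; apply/rowP => i; rewrite mxE toS to0 addrK.
- move=> y /standard_simplexP[_ y1]; apply/rowP => k.
  have [i ->|->] := unliftP ord0 k; rewrite ?toS ?to0 weight_of// mxE.
  by rewrite subrK.
- move=> w; pose W := (\sum_k w 0 k) / d.+1%:R.
  exists (\row_i (w 0 (lift ord0 i) - W)), W => x.
  rewrite /pairing big_ord_recl to0.
  under eq_bigr do rewrite toS mulrDr.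
  under [in RHS]eq_bigr do rewrite mxE mulrBl.
  rewrite big_split sumrB /= -!mulr_suml -mulr_sumr addrCA -mulrDl -big_ord_recl -addrA.
  by congr (_ + _); rewrite addrC -{1}[W]mulr1 -mulrBr /W /weight mulrA mulrAC.
move=> w.
exists (\row_k (if unlift ord0 k is Some i then w 0 i else - \sum_i w 0 i)), 0 => y.
rewrite addr0 /pairing big_ord_recl mxE unlift_none.
rewrite mulNr addrC mulr_suml -sumrB; apply: eq_bigr => i _.
by rewrite !mxE liftK mulrBr.
Qed.

End Simplex.

Theorem corollary3p4 (R : realType) :
  (forall d : nat,
     (exists2 P : set 'rV[R]_d, reflexive_polytope P &
        combinatorially_isomorphic P (simplex R d)) /\
     (exists2 P : set 'rV[R]_d, reflexive_polytope P &
        combinatorially_isomorphic P (cube R d)) /\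
     (exists2 P : set 'rV[R]_d, reflexive_polytope P &
        combinatorially_isomorphic P (crosspolytope R d))) /\
  (~ (exists2 P : set 'rV[R]_3, reflexive_polytope P &
        combinatorially_isomorphic P (dodecahedron R)) /\
   ~ (exists2 P : set 'rV[R]_3, reflexive_polytope P &
        combinatorially_isomorphic P (icosahedron R))) /\
  (~ (exists2 P : set 'rV[R]_4, reflexive_polytope P &
        combinatorially_isomorphic P (cell120 R)) /\
   ~ (exists2 P : set 'rV[R]_4, reflexive_polytope P &
        combinatorially_isomorphic P (cell600 R))).
Proof.
split=> [d|]; first split; [|split|].
- exists (convex_hull (range (@simplex_vertex R d))); first exact: simplex_reflexive.
  exact: simplex_isomorphic.
- exists (cube R d); first exact: cube_reflexive.
  exact: combinatorially_isomorphic_refl.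
- exists (crosspolytope R d); first exact: crosspolytope_reflexive.
  exact: combinatorially_isomorphic_refl.
rewrite dodecahedronE icosahedronE cell120E cell600E.
split; split=> -[P reflP].
- exact: (golden_certificate_simple dodecahedron_certificate reflP).
- exact: (golden_certificate_simplicial dodecahedron_certificate reflP).
- exact: (golden_certificate_simple cell120_certificate reflP).
- exact: (golden_certificate_simplicial cell120_certificate reflP).
Qed.
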